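(* Let $V\in\mathcal V(\Omega)$ be such that $Q_V\succeq0$ in $\Omega$. Then $V$ is strongly balanced in $\Omega$.
   Context: $\Omega$ is a domain (nonempty connected open set) in $\mathbb R^N$, $N\ge1$; $V^\pm=\max\{\pm V,0\}$; $A\Subset\Omega$ means $\overline A$ is a compact subset of $\Omega$. $W^{1,\infty}_c(\Omega)$: Lipschitz functions with compact support in $\Omega$; $Q_V(\xi)=\int_\Omega\{|\nabla\xi|^2+V\xi^2\}\,dx$; $Q_V\succeq0$ in $\Omega$ means $Q_V(\xi)\ge0$ for all $\xi\in W^{1,\infty}_c(\Omega)$. $\mathcal V(\Omega)$ is the class of functions $V\in L^1_{loc}(\Omega)$ for which there is a cover of $\Omega$ by open sets $\{U_j\}$, $U_j\Subset\Omega$, such that for each $j$ either $V^+$ is (essentially) bounded on $U_j$, or else there exists an open set $O_j$ with $U_j\Subset O_j\Subset\Omega$ and $V^-$ (essentially) bounded on $O_j$. $V\in L^1_{loc}(\Omega)$ is strongly balanced in $\Omega$ if $Q_V\succeq0$ in $\Omega$ and for every compact $K\subset\Omega$ there exist an open set $U\Subset\Omega$ containing $K$ and a constant $c>0$ (depending on $K,U$) such that $c\int_KV^+|\xi|\le\sqrt{Q_V(\xi)}+\int_U|\xi|$ for all $\xi\in W^{1,\infty}_c(\Omega)$. *)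

(* Defs.v *)
From HB Require Import structures.
From mathcomp Require Import all_boot all_order all_algebra.
From mathcomp Require Import all_classical all_reals all_analysis.

Set Implicit Arguments.
Unset Strict Implicit.
Unset Printing Implicit Defensive.

Import Order.TTheory GRing.Theory Num.Theory.
Import numFieldNormedType.Exports.

Local Open Scope classical_set_scope.
Local Open Scope ring_scope.

(* The product sigma-algebra on R^n, generated by the coordinate functions; it
   coincides with the Borel sigma-algebra of 'rV[R]_n. *)
Definition rV_display : measure_display.
Proof. exact: measure_tuple_display default_measure_display. Qed.

Section measurable_rV.
Variables (R : realType) (n : nat).

Let coord (i : 'I_n) (x : 'rV[R]_n) : measurableTypeR R := x ord0 i.

Let rV_set0 : g_sigma_preimage coord set0.
Proof. exact: sigma_algebra0. Qed.

Let rV_setC A : g_sigma_preimage coord A -> g_sigma_preimage coord (~` A).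
Proof. exact: sigma_algebraC. Qed.

Let rV_bigcup (F : (set 'rV[R]_n)^nat) :
  (forall i, g_sigma_preimage coord (F i)) ->
  g_sigma_preimage coord (\bigcup_i (F i)).
Proof. exact: sigma_algebra_bigcup. Qed.

HB.instance Definition _ := @isMeasurable.Build rV_display
  'rV[R]_n (g_sigma_preimage coord) rV_set0 rV_setC rV_bigcup.

End measurable_rV.

Section rV_measurability.
Variable R : realType.

Lemma measurable_coord n (i : 'I_n) :
  measurable_fun setT (fun x : 'rV[R]_n => x ord0 i : measurableTypeR R).
Proof.
move=> _ Y mY; rewrite setTI; apply: sub_sigma_algebra => /=.
rewrite -bigcup_seq/=; exists i => /=; first by rewrite mem_index_enum.
by exists Y => //; rewrite setTI.
Qed.

Lemma measurable_fun_coordP d (T : measurableType d) n (f : T -> 'rV[R]_n) :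
  (forall i, measurable_fun setT (fun t => f t ord0 i : measurableTypeR R)) ->
  measurable_fun setT f.
Proof.
move=> mf; pose G := [set A : set 'rV[R]_n | measurable (f @^-1` A)].
suff : @measurable _ 'rV[R]_n `<=` G.
  by move=> sG _ A mA; rewrite setTI; exact: sG.
apply: smallest_sub.
  split => /=; first by rewrite /G/= preimage_set0.
    by move=> A; rewrite /G/= setTD preimage_setC => mA; exact: measurableC.
  move=> F mF; rewrite /G/= preimage_bigcup.
  by apply: bigcup_measurable => k _; exact: mF.
rewrite -bigcup_seq => A [i _ [B mB <-]].
rewrite /G/= setTI; have := mf i measurableT B mB.
by rewrite setTI.
Qed.

Lemma open_measurable_rV n (O : set 'rV[R]_n) : open O -> measurable O.
Proof.
move=> oO.
pose c (qm : 'rV[rat]_n * nat) : 'rV[R]_n := map_mx ratr qm.1.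
pose b (qm : 'rV[rat]_n * nat) : set 'rV[R]_n := ball (c qm) qm.2.+1%:R^-1.
have mb qm : measurable (b qm).
  have -> : b qm = \bigcap_(i in [set: 'I_n])
      ((fun x : 'rV[R]_n => x ord0 i : measurableTypeR R) @^-1`
        ball (c qm ord0 i) qm.2.+1%:R^-1).
    apply/seteqP; split => [x [_ bx] i _|x bx]; first exact: bx.
    by split; [rewrite invr_gt0|move=> i j; rewrite ord1; exact: bx].
  apply: fin_bigcap_measurable => // i _.
  rewrite -[X in measurable X]setTI; apply: measurable_coord => //.
  by apply: measurable_realfun.open_measurable; exact: ball_open.
have -> : O = \bigcup_(qm in [set qm | b qm `<=` O]) b qm.
  apply/seteqP; split => [x Ox|x [qm /= bO]]; last exact: bO.
  have /nbhs_ballP[e /= e0 eO] : nbhs x O by exact: open_nbhs_nbhs.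
  have [m me] : exists m : nat, m.+1%:R^-1 + m.+1%:R^-1 < e.
    have e20 : 0 < e / 2 by rewrite divr_gt0.
    exists (Num.trunc (e / 2)^-1).
    have h : (Num.trunc (e / 2)^-1).+1%:R^-1 < e / 2.
      by rewrite invf_plt ?posrE// truncnS_gt.
    by rewrite [ltRHS]splitr ltrD.
  have q_ i : {q : rat | `|ratr q - x ord0 i| < m.+1%:R^-1}.
    apply: cid; set y := x ord0 i.
    have : y - m.+1%:R^-1 < y + m.+1%:R^-1.
      by rewrite ltrD2l gtrN// invr_gt0.
    by move=> /rat_in_itvoo[q]; rewrite in_itv/= -ltr_distl => ?; exists q.
  pose qm := (\row_i projT1 (q_ i), m).
  have qx i : ball (c qm ord0 i) m.+1%:R^-1 (x ord0 i).
    by rewrite /ball/= !mxE; case: (q_ i).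
  have bx : b qm x.
    by split; [rewrite invr_gt0|move=> i j; rewrite ord1; exact: qx].
  exists qm => //= y by_; apply: eO.
  by apply: le_ball (ltW me) _ _; apply: ball_triangle by_; exact: ball_sym.
rewrite bigcup_mkcond; apply: countable_bigcupT_measurable => [|qm].
  exact: countableP.
by case: ifP.
Qed.

Definition row_cons n (p : measurableTypeR R * 'rV[R]_n) : 'rV[R]_n.+1 :=
  row_mx p.1%:M p.2.

Lemma row_cons0 n p : @row_cons n p ord0 ord0 = p.1.
Proof.
rewrite /row_cons (_ : ord0 = lshift n (ord0 : 'I_1)); last exact: val_inj.
by rewrite (@row_mxEl _ 1 1 n) !mxE eqxx mulr1n.
Qed.

Lemma row_consS n p i : @row_cons n p ord0 (lift ord0 i) = p.2 ord0 i.
Proof.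
rewrite /row_cons (_ : lift ord0 i = rshift 1 i); last exact: val_inj.
by rewrite (@row_mxEr _ 1 1 n).
Qed.

Lemma measurable_row_cons n : measurable_fun setT (@row_cons n).
Proof.
apply: measurable_fun_coordP => i.
case: (unliftP ord0 i) => [j|] ->.
  under eq_fun do rewrite row_consS.
  exact: (measurableT_comp (measurable_coord j) measurable_snd).
under eq_fun do rewrite row_cons0.
exact: measurable_fst.
Qed.

Definition row_uncons n (x : 'rV[R]_n.+1) : measurableTypeR R * 'rV[R]_n :=
  (x ord0 ord0, \row_i x ord0 (lift ord0 i)).

Lemma row_consK n : cancel (@row_cons n) (@row_uncons n).
Proof.
move=> [x y]; rewrite /row_uncons row_cons0; congr pair.
by apply/rowP => i; rewrite mxE row_consS.
Qed.

Lemma measurable_row_uncons n : measurable_fun setT (@row_uncons n).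
Proof.
apply: measurable_fun_pair; first exact: measurable_coord.
apply: measurable_fun_coordP => i; under eq_fun do rewrite mxE.
exact: measurable_coord.
Qed.

Local Open Scope ereal_scope.

Section lebesgue_cons.
Variables (n : nat) (mu : {sigma_finite_measure set 'rV[R]_n -> \bar R}).

Definition lebesgue_cons : set 'rV[R]_n.+1 -> \bar R :=
  pushforward (lebesgue_measure \x mu) (@row_cons n).

Let mrow_cons := @measurable_row_cons n.

Let lebesgue_cons0 : lebesgue_cons set0 = 0.
Proof. exact: measure0. Qed.

Let lebesgue_cons_ge0 A : 0 <= lebesgue_cons A.
Proof. exact: measure_ge0. Qed.

Let lebesgue_cons_sigma_additive : semi_sigma_additive lebesgue_cons.
Proof. exact: measure_semi_sigma_additive. Qed.

HB.instance Definition _ := isMeasure.Build _ _ _ lebesgue_cons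
  lebesgue_cons0 lebesgue_cons_ge0 lebesgue_cons_sigma_additive.

Let lebesgue_cons_sigma_finite : sigma_finite setT lebesgue_cons.
Proof.
have /sigma_finiteP[F [FT ndF Foo]] := sigma_finiteT (@lebesgue_measure R).
have /sigma_finiteP[G [GT ndG Goo]] := sigma_finiteT mu.
exists (fun k => @row_uncons n @^-1` (F k `*` G k)).
  apply/esym/seteqP; split => // x _.
  have [k _ Fk] : (\bigcup_k F k) (x ord0 ord0) by rewrite -FT.
  have [l _ Gl] : (\bigcup_k G k) (row_uncons x).2 by rewrite -GT.
  exists (maxn k l) => //; split => /=.
    by move: Fk; exact/subsetPset/ndF/leq_maxl.
  by move: Gl; exact/subsetPset/ndG/leq_maxr.
move=> k; have [mF Fk] := Foo k; have [mG Gk] := Goo k; split.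
  rewrite -[X in measurable X]setTI; apply: measurable_row_uncons => //.
  exact: measurableX.
rewrite /lebesgue_cons /pushforward -comp_preimage.
have -> : @row_uncons n \o @row_cons n = id by apply/funext; exact: row_consK.
by rewrite preimage_id product_measure1E// lte_mul_pinfty// ge0_fin_numE.
Qed.

HB.instance Definition _ := Measure_isSigmaFinite.Build _ _ _ lebesgue_cons
  lebesgue_cons_sigma_finite.

End lebesgue_cons.

Fixpoint lebesgue_rV n : {sigma_finite_measure set 'rV[R]_n -> \bar R} :=
  match n with
  | 0%N => \d_(0%R : 'rV[R]_0)
  | m.+1 => lebesgue_cons (lebesgue_rV m)
  end.

Lemma lebesgue_rV_box n (a b : 'rV[R]_n) : (forall i, a ord0 i <= b ord0 i)%R ->
  lebesgue_rV n
    [set x : 'rV[R]_n | forall i, x ord0 i \in `[a ord0 i, b ord0 i]%R] =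
  (\prod_(i < n) (b ord0 i - a ord0 i))%:E.
Proof.
elim: n a b => [|n IHn] a b ab /=.
  by rewrite big_ord0 diracE mem_set//= => -[].
rewrite /lebesgue_cons /pushforward.
pose a' : 'rV[R]_n := \row_i a ord0 (lift ord0 i).
pose b' : 'rV[R]_n := \row_i b ord0 (lift ord0 i).
have -> : @row_cons n @^-1`
      [set x : 'rV[R]_n.+1 | forall i, x ord0 i \in `[a ord0 i, b ord0 i]%R] =
    `[a ord0 ord0, b ord0 ord0]%classic `*`
      [set x : 'rV[R]_n | forall i, x ord0 i \in `[a' ord0 i, b' ord0 i]%R].
  apply/seteqP; split => [[x y] /= h|[x y] /= [h0 hS] i].
    split; first by have := h ord0; rewrite row_cons0.
    by move=> i; have := h (lift ord0 i); rewrite row_consS !mxE.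
  case: (unliftP ord0 i) => [j|] ->; last by rewrite row_cons0.
  by have := hS j; rewrite row_consS !mxE.
rewrite product_measure1E//; last first.
  rewrite [X in measurable X](_ : _ = \bigcap_(i in [set: 'I_n])
      ((fun x : 'rV[R]_n => x ord0 i : measurableTypeR R) @^-1`
        `[a' ord0 i, b' ord0 i]%classic)); last first.
    by apply/seteqP; split => [x h i _|x h i]; [exact: h|exact: (h i)].
  apply: fin_bigcap_measurable => // i _.
  by rewrite -[X in measurable X]setTI; exact: measurable_coord.
rewrite IHn => [|i]; last by rewrite !mxE.
rewrite big_ord_recl EFinM; congr (_ * _); last first.
  by congr EFin; apply: eq_bigr => i _; rewrite !mxE.
apply: (etrans (lebesgue_measure_itv `[a ord0 ord0, b ord0 ord0]%R)) => /=.
rewrite lte_fin; have := ab ord0; rewrite le_eqVlt => /orP[/eqP ->|->//].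
by rewrite ltxx subrr.
Qed.

End rV_measurability.

Local Close Scope ereal_scope.

Section balanced_potentials.
Variables (R : realType) (N : nat).
Local Notation mu := (lebesgue_rV R N).
Implicit Types (Omega U A : set 'rV[R]_N) (V xi : 'rV[R]_N -> R).

Definition domain Omega := [/\ open Omega, connected Omega & Omega !=set0].

Definition compactly_contained A Omega :=
  compact (closure A) /\ closure A `<=` Omega.

(* The sigma-algebra of 'rV[R]_N is not completed by null sets, so that a
   Lebesgue measurable function is one that agrees a.e. with a measurable one.
   The library integral (a supremum of integrals of simple functions) is
   invariant under modification of the integrand on a null set, measurable or
   not. *)
Definition lebesgue_measurable_fun Omega V := exists2 W : 'rV[R]_N -> R,
  measurable_fun Omega W & {ae mu, forall x, Omega x -> V x = W x}.

(* Elements of L^1_loc(Omega) and functions on Omega are represented by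
   functions on the whole space; their values outside Omega are irrelevant. *)
Definition L1_loc Omega V := lebesgue_measurable_fun Omega V /\
  forall K, compact K -> K `<=` Omega ->
    (\int[mu]_(x in K) `|V x|%:E < +oo)%E.

Definition ess_bounded_on U V :=
  exists M : R, {ae mu, forall x, U x -> `|V x| <= M}.

(* Test functions are extended by zero outside Omega. *)
Definition Lip_c Omega xi :=
  [/\ lipschitz xi, compact (closure [set x | xi x != 0]) &
      closure [set x | xi x != 0] `<=` Omega].

Definition gradient xi (x : 'rV[R]_N) : 'rV[R]_N :=
  \row_i 'D_(delta_mx ord0 i) xi x.

(* The Euclidean norm; the library norm of 'rV[R]_N is the sup norm. *)
Definition sqr_norm (v : 'rV[R]_N) : R := \sum_(i < N) v ord0 i ^+ 2.

(* For V in L^1_loc and xi in Lip_c, the integrand is defined a.e. (by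
   Rademacher's theorem) and integrable. *)
Definition Qform Omega V xi : R :=
  \int[mu]_(x in Omega) (sqr_norm (gradient xi x) + V x * xi x ^+ 2).

Definition Qform_ge0 Omega V :=
  forall xi, Lip_c Omega xi -> 0 <= Qform Omega V xi.

Definition class_V Omega V := L1_loc Omega V /\
  exists (J : Type) (U : J -> set 'rV[R]_N),
    Omega `<=` \bigcup_j U j /\
    forall j, [/\ open (U j), compactly_contained (U j) Omega &
      ess_bounded_on (U j) V^\+ \/
      exists O : set 'rV[R]_N, [/\ open O, compactly_contained (U j) O,
        compactly_contained O Omega & ess_bounded_on O V^\-]].

Definition strongly_balanced Omega V := [/\ L1_loc Omega V,
  Qform_ge0 Omega V &
  forall K, compact K -> K `<=` Omega ->
    exists U : set 'rV[R]_N, exists c : R,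
      [/\ open U, compactly_contained U Omega, K `<=` U, 0 < c &
        forall xi, Lip_c Omega xi ->
          c * \int[mu]_(x in K) (V^\+ x * `|xi x|) <=
          Num.sqrt (Qform Omega V xi) + \int[mu]_(x in U) `|xi x|]].

End balanced_potentials.

(* Main.v *)
Require Import Defs.
From HB Require Import structures.
From mathcomp Require Import all_boot all_order all_algebra.
From mathcomp Require Import all_classical all_reals all_analysis.
From mathcomp Require Import measurable_realfun ring lra.

Set Implicit Arguments.
Unset Strict Implicit.
Unset Printing Implicit Defensive.

Import Order.TTheory GRing.Theory Num.Theory.
Import numFieldNormedType.Exports.

Local Open Scope classical_set_scope.
Local Open Scope ring_scope.

(** The point is that nonnegativity makes Q = Qform Omega V satisfy the
    Cauchy-Schwarz inequality, so that testing against one fixed bump function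
    already controls the potential from above.

    Write B(f, g) for the polar form of Q, the integral of
    (grad f . grad g + V f g).  Replacing xi by |xi| changes neither Q(xi) nor
    the inequality to prove, so take xi >= 0.  For a bump phi >= 0,
    Cauchy-Schwarz gives B(xi, phi) <= sqrt Q(xi) sqrt Q(phi), and integrating
    by parts turns the gradient term of B(xi, phi) into minus the integral of
    xi Laplacian(phi).  Hence the integral of V xi phi is at most a multiple of
    sqrt Q(xi) + (the integral of xi near the support of phi), which is
    potential_bump_le.  Where the negative part of V is bounded, V^- xi phi is
    absorbed by the integral of xi, and where phi is bounded below this bounds
    the integral of V^+ xi (controlled_bounded_below).  Where V^+ itself is
    bounded the estimate is immediate (controlled_bounded_above).  Every point
    of Omega is of one of these two kinds, so finitely many such neighbourhoods
    cover a compact set, and the estimates add up (controlled_cover).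

    The analytic input is about Lipschitz functions: their partial derivatives
    exist almost everywhere and those of a compactly supported one integrate to
    0.  On the line, adding a multiple of x to f gives a nondecreasing function
    whose Lebesgue-Stieltjes measure is dominated by Lebesgue measure; its
    Radon-Nikodym density is the derivative by the Lebesgue differentiation
    theorem (lipschitz_line_derivative).  In dimension n one slices along each
    coordinate and uses Fubini (rademacher), which requires the set of points
    of derivability to be Borel (measurable_derivable).  The bump is
    max(0, r^2 - |x - a|^2)^2: its first derivatives are Lipschitz, hence its
    second ones exist almost everywhere and are bounded, and that suffices for
    the integration by parts. *)

(** * Lipschitz functions on the line *)

Lemma ler_dist_max (R : realDomainType) (c s t : R) :
  `|Num.max c s - Num.max c t| <= `|s - t|.
Proof.
rewrite ler_norml; have := ler_norm (s - t); have := ler_norm (- (s - t)).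
rewrite normrN; have : 0 <= `|s - t| by []; set m := `|_|.
by case: (leP c s) => ?; case: (leP c t) => ? *; apply/andP; split; lra.
Qed.

Lemma ler_dist_min (R : realDomainType) (c s t : R) :
  `|Num.min s c - Num.min t c| <= `|s - t|.
Proof.
rewrite ler_norml; have := ler_norm (s - t); have := ler_norm (- (s - t)).
rewrite normrN; have : 0 <= `|s - t| by []; set m := `|_|.
by case: (leP s c) => ?; case: (leP t c) => ? *; apply/andP; split; lra.
Qed.

Section line.
Context {R : realType}.
Local Notation leb := (@lebesgue_measure R).
Variables (f : R -> R) (L M : R).
Hypotheses (Lpos : 0 < L) (Mpos : 0 < M)
  (fL : forall x y, `|f x - f y| <= L * `|x - y|)
  (fM : forall x, M <= `|x| -> f x = 0).

Let clip x : R := Num.max (- M) (Num.min x M).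

Let clip_le x y : x <= y -> 0 <= clip y - clip x <= y - x.
Proof.
move=> xy; apply/andP; split.
  by rewrite subr_ge0 /clip; apply: le_max2 => //; apply: le_min2.
apply: le_trans (ler_norm _) (le_trans (ler_dist_max _ _ _) _).
by apply: le_trans (ler_dist_min _ _ _) _; rewrite ger0_norm// subr_ge0.
Qed.

(** Adding L x makes f nondecreasing; cutting x off at -M and M, where f
    vanishes, and rescaling makes it a distribution function, so that its
    Lebesgue-Stieltjes measure is a probability and the Radon-Nikodym theorem
    for finite measures applies. *)
Definition ramp x : R := (f x + L * (clip x + M)) / (2 * L * M).

Let LM0 : 0 < 2 * L * M. Proof. by rewrite !mulr_gt0. Qed.

Let f_clip x : f x = f (clip x).
Proof.
have fMM : f M = 0 by rewrite fM// ger0_norm// ltW.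
have fNM : f (- M) = 0 by rewrite fM// normrN ger0_norm// ltW.
rewrite /clip; case: (leP x M) => xM.
  have Mpos' := Mpos; case: (leP (- M) x) => // xNM; rewrite fNM fM//.
  by rewrite ler0_norm; lra.
have Mpos' := Mpos; rewrite max_r; last lra.
by rewrite fMM fM// gtr0_norm; lra.
Qed.

Let ramp_le x y : x <= y -> 0 <= ramp y - ramp x <= M^-1 * (y - x).
Proof.
move=> xy; have -> : ramp y - ramp x =
    (f y - f x + L * (clip y - clip x)) / (2 * L * M).
  by rewrite /ramp; field; rewrite !gt_eqF.
have -> : M^-1 * (y - x) = (2 * L * (y - x)) / (2 * L * M).
  by field; rewrite !gt_eqF.
have Lpos' := Lpos; have /andP[c0 c1] := clip_le xy.
have := fL (clip y) (clip x); rewrite -!f_clip (ger0_norm c0) => fyx.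
have := ler_norm (f y - f x); have := ler_norm (- (f y - f x)).
rewrite normrN => h1 h2.
have Lc : L * (clip y - clip x) <= L * (y - x) by rewrite ler_pM2l.
apply/andP; split.
  by rewrite divr_ge0 ?(ltW LM0)//; lra.
by rewrite ler_pM2r ?invr_gt0//; lra.
Qed.

Let ramp_nd : nondecreasing ramp.
Proof. by move=> x y /ramp_le/andP[]; rewrite subr_ge0. Qed.

Let linB_nd : nondecreasing (fun x => M^-1 * x - ramp x).
Proof.
by move=> x y /ramp_le/andP[_]; rewrite mulrBr; set a := _ * y; set b := _ * x; lra.
Qed.

Let lip_rc (h : R -> R) K : 0 < K -> nondecreasing h ->
  (forall x y, x <= y -> h y - h x <= K * (y - x)) ->
  right_continuous h.
Proof.
move=> K0 ndh hK x; apply/cvgrPdist_le => e e0; near=> y.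
have xy : x <= y by near: y; exact: nbhs_right_ge.
rewrite distrC ger0_norm ?subr_ge0 ?ndh//.
apply: (le_trans (hK _ _ xy)); rewrite -ler_pdivlMl//.
rewrite lerBlDl; near: y; apply: nbhs_right_le.
by rewrite ltrDl mulr_gt0// invr_gt0.
Unshelve. all: by end_near. Qed.

Let Mi0 : 0 < M^-1. Proof. by rewrite invr_gt0. Qed.

Let ramp_rc : right_continuous ramp.
Proof. by apply: (lip_rc Mi0) => // x y /ramp_le/andP[]. Qed.

Let linB_rc : right_continuous (fun x => M^-1 * x - ramp x).
Proof.
apply: (lip_rc Mi0) => // x y /ramp_le/andP[] + _.
by rewrite mulrBr; set a := _ * y; set b := _ * x; lra.
Qed.

HB.instance Definition _ := isCumulative.Build R _ R ramp ramp_nd ramp_rc.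

Let linB x : R := M^-1 * x - ramp x.
HB.instance Definition _ := isCumulative.Build R _ R linB linB_nd linB_rc.

Let ramp_ge x : M <= x -> ramp x = 1.
Proof.
have Mpos' := Mpos; move=> Mx; rewrite /ramp fM; last by rewrite ger0_norm//; lra.
rewrite /clip min_r// max_r; last lra.
by field; rewrite !gt_eqF.
Qed.

Let ramp_lt x : x <= - M -> ramp x = 0.
Proof.
have Mpos' := Mpos; move=> Mx; rewrite /ramp fM; last by rewrite ler0_norm//; lra.
rewrite /clip min_l; last lra.
rewrite max_l//; by rewrite addNr mulr0 add0r mul0r.
Qed.

Let ramp_cvgNy : ramp @ -oo --> (0 : R).
Proof.
apply/cvgrPdist_le => e e0; near=> x.
have -> : ramp x = 0.
  apply: ramp_lt; apply: ltW; near: x.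
  by apply: nbhs_ninfty_lt; rewrite num_real.
by rewrite subrr normr0 ltW.
Unshelve. all: by end_near. Qed.

Let ramp_cvgy : ramp @ +oo --> (1 : R).
Proof.
apply/cvgrPdist_le => e e0; near=> x.
have -> : ramp x = 1.
  apply: ramp_ge; apply: ltW; near: x.
  by apply: nbhs_pinfty_gt; rewrite num_real.
by rewrite subrr normr0 ltW.
Unshelve. all: by end_near. Qed.

HB.instance Definition _ := isCumulativeBounded.Build R 0 1 ramp ramp_cvgNy ramp_cvgy.

Let P := lebesgue_stieltjes_measure ramp.

Let lsE (h : cumulative R R) (a b : R) : a <= b ->
  lebesgue_stieltjes_measure h `]a, b]%classic = (h b - h a)%:E.
Proof.
move=> ab; rewrite /lebesgue_stieltjes_measure /measure_extension.
by rewrite measurable_mu_extE/=; [rewrite wlength_itv_bnd|exact: is_ocitv].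
Qed.

(** The function M^-1 x - ramp x is nondecreasing too, and its measure added to
    that of ramp is M^-1 times Lebesgue measure; hence P is dominated. *)
Let P_dom : P `<< leb.
Proof.
apply/null_content_dominatesP => A mA A0.
pose Q := lebesgue_stieltjes_measure linB.
have M0 : 0 <= M by exact: ltW.
have E X : measurable X -> leb X = (mscale (NngNum M0) (measure_add P Q)) X.
  apply: lebesgue_stieltjes_measure_unique => {A mA A0} X.
  have PQ : mscale (NngNum M0) (measure_add P Q) X = (M%:E * (P X + Q X))%E.
    by congr (_ * _)%E; exact: measure_addE.
  move=> oX; apply: etrans (esym PQ); move: oX => {PQ}/ocitvP[->|[[a b] /= ab ->]].
    by rewrite /P /Q !measure0 adde0 mule0.
  rewrite (@lsE idfun) ?(ltW ab)// /P /Q !lsE ?(ltW ab)//.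
  rewrite -EFinD -EFinM; congr EFin; rewrite /= /linB /=; field.
  by rewrite gt_eqF.
have : leb A = (M%:E * (P A + Q A))%E.
  by rewrite E//; congr (_ * _)%E; exact: measure_addE.
rewrite A0 => /esym/eqP.
rewrite mule_eq0 eqe (gt_eqF Mpos)/= padde_eq0//.
by move=> /andP[/eqP].
Qed.
Let M0 : - M < M. Proof. have Mpos' := Mpos; lra. Qed.

Let fM' x : M < `|x| -> is_derive x (1:R) f 0.
Proof.
move=> xM; apply: (@near_eq_is_derive _ _ _ (cst 0)).
near=> y; apply/esym/fM/ltW; near: y.
have: (`|y| : R) @[y --> x] --> `|x| by apply: cvg_norm; exact: cvg_id.
by move/cvgr_gt; apply.
Unshelve. all: by end_near. Qed.

(** The density of P gives the derivative inside ]-M, M[, up to an affine change;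
    the integral is the
    total increment of f there, which is 0. *)
Lemma lipschitz_line_derivative : exists d : R -> R,
  [/\ leb.-integrable setT (EFin \o d), \int[leb]_x d x = 0 &
    {ae leb, forall x, is_derive x (1:R) f (d x)}].
Proof.
have [k [k0 kfin ki kE]] := radon_nikodym_sigma_finite P_dom.
pose I := `]- M, M]%classic : set R.
have kE' : EFin \o (fine \o k) = k by apply/funext => x /=; rewrite fineK.
pose e (x : R) := 2 * L * M * fine (k x) - L.
have mI : measurable I by exact: measurable_itv.
have iI : leb.-integrable I (EFin \o (fine \o k)).
  by rewrite kE'; apply: integrableS ki.
have leI : leb I = (M + M)%:E.
  apply: etrans (lebesgue_measure_itv `]- M, M]%R) _.
  by rewrite /= lte_fin M0 -EFinB opprK.
have iL : leb.-integrable I (EFin \o cst L).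
  apply: measurable_bounded_integrable => //.
    by have := ltry (M + M); rewrite -leI.
  by exists `|L|; split; [rewrite num_real|move=> y /ltW ? x _].
have iIe : leb.-integrable I (EFin \o e).
  rewrite /e (_ : _ \o _ = (fun x => (2 * L * M)%:E * (EFin \o (fine \o k)) x)
    \- (EFin \o cst L))%E; last by apply/funext => x /=.
  by apply: integrableB => //; exact: integrableZl.
pose F y := \int[leb]_(x in `]- M, y]) fine (k x).
have FE y : - M <= y -> F y = ramp y.
  move=> My; rewrite /F /Rintegral.
  under eq_integral do rewrite fineK//.
  have PE : P `]- M, y]%classic = (ramp y - ramp (- M))%:E by exact: lsE.
  pose J : set R := `]- M, y]%classic.
  have -> : (\int[leb]_(x in J) k x)%E = (ramp y - ramp (- M))%:E.
    by apply: etrans (esym (kE _ _)) PE; exact: measurable_itv.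
  by rewrite /= (@ramp_lt (- M))// subr0.
exists (e \_ I); split.
- rewrite -restrict_EFin;
  exact: ((@integrable_mkcond _ (measurableTypeR R) R leb I (EFin \o e) mI).1 iIe).
- rewrite -Rintegral_mkcond RintegralB//; last first.
    by rewrite (_ : _ \o _ = (fun x => (2 * L * M)%:E * (EFin \o (fine \o k)) x)%E)//;
      exact: integrableZl.
  rewrite RintegralZl// -/(F M) FE ?(ltW M0)// ramp_ge ?lexx//.
  apply: (@etrans _ _ (2 * L * M * 1 - L * (M + M))); last by ring.
  congr (_ - _); apply: (etrans (@Rintegral_cst _ (measurableTypeR R) R leb I mI L)).
  by congr (_ * _); have := congr1 fine leI.
- have aeF := @FTC1 R (fine \o k) (BRight (- M)).
  have [aeM aeN] : {ae leb, forall x, x != M} /\ {ae leb, forall x, x != - M}.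
    split.
    + by exists [set M]; split; [|exact: lebesgue_measure_set1|
        move=> x /= /negP; rewrite negbK => /eqP].
    + by exists [set - M]; split; [|exact: lebesgue_measure_set1|
        move=> x /= /negP; rewrite negbK => /eqP].
  have {aeF} := aeF _ _; rewrite -/F => aeF.
  have {}aeF : {ae leb, forall x, - M < x ->
      derivable F x 1 /\ F^`()%classic x = fine (k x)}.
    apply: aeF.
    + by move=> y; rewrite kE'; apply: integrableS ki.
    + apply: open_integrable_locally; first exact: openT.
      by rewrite kE'.
  apply: (filterS3 (ae_filter_ringOfSetsType leb) _ aeF aeM aeN) => x Fx xM xNM.
  rewrite patchE; case: ifPn => [|]; last first.
    rewrite notin_setE /I/= in_itv/= => /negP xI; apply: fM'.
    move: xI; rewrite negb_and -leNgt -ltNge => /orP[h|h].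
      rewrite ltr0_norm; last by rewrite (le_lt_trans h)// oppr_lt0.
      by rewrite ltrNr lt_neqAle xNM.
    by rewrite gtr0_norm// (lt_trans _ h).
  rewrite inE /I/= in_itv/= => /andP[Mx xM'].
  have {}xM' : x < M by rewrite lt_neqAle xM.
  have [dF F'x] := Fx Mx.
  apply: (@near_eq_is_derive _ _ _
    (fun y => (2 * L * M) *: F y - L *: (y + M))).
    near=> y.
    have yM : y < M by near: y; exact: lt_nbhsl.
    have My : - M < y by near: y; exact: lt_nbhsr.
    rewrite FE ?ltW// /ramp /clip min_l ?max_r ?ltW// /GRing.scale/=; field.
    by rewrite !gt_eqF.
  have -> : e x = (2 * L * M) *: F^`()%classic x - L *: (1 + 0).
    by rewrite F'x addr0 /GRing.scale/= mulr1.
  apply: is_deriveB; apply: is_deriveZ.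
  rewrite derive1E; exact: derivableP.
Unshelve. all: by end_near. Qed.
End line.

(** * Points of derivability *)

Section derivability_set.
Context {R : realType} {V : normedModType R}.
Implicit Types (f : V -> R) (v x : V) (h : R).

Definition diff_quotient f v h x : R := h^-1 * (f (h *: v + x) - f x).

Definition rational_steps (m : nat) (pq : rat * rat) :=
  [&& pq.1 != 0, pq.2 != 0, `|ratr pq.1 : R| < m.+1%:R^-1
    & `|ratr pq.2 : R| < m.+1%:R^-1].

(** The Cauchy condition for difference quotients along rational steps: it
    involves countably many of them, hence defines a Borel set. *)
Definition rationally_derivable f v x := forall k : nat, exists m : nat,
  forall pq : rat * rat, rational_steps m pq ->
  `|diff_quotient f v (ratr pq.1) x - diff_quotient f v (ratr pq.2) x|
    <= k.+1%:R^-1.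

Lemma ratr_neq0 (q : rat) : q != 0 -> (ratr q : R) != 0.
Proof. by rewrite fmorph_eq0. Qed.

Lemma exists_natinv_lt (e : R) : 0 < e -> exists m : nat, m.+1%:R^-1 < e.
Proof.
move=> e0; exists (Num.trunc e^-1).
by rewrite invf_plt ?posrE// truncnS_gt.
Qed.

Lemma derivable_rationally f v x :
  derivable f x v -> rationally_derivable f v x.
Proof.
move=> /cvg_ex[l /= fl] k.
have k0 : 0 < k.+1%:R^-1 / 2 :> R by rewrite divr_gt0// invr_gt0.
move/cvgrPdist_lt : fl => /(_ _ k0)[e /= e0 he].
have [m me] := exists_natinv_lt e0.
exists m => -[p q] /and4P[/= p0 q0 pm qm].
have hp (r : rat) : r != 0 -> `|ratr r : R| < m.+1%:R^-1 ->
    `|l - diff_quotient f v (ratr r) x| < k.+1%:R^-1 / 2.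
  move=> r0 rm; apply: he; last exact: ratr_neq0.
  by rewrite /= sub0r normrN (lt_trans rm).
rewrite (_ : _ - _ = (l - diff_quotient f v (ratr q) x) -
   (l - diff_quotient f v (ratr p) x)); last by ring.
apply/ltW/(le_lt_trans (ler_normB _ _)).
by rewrite [ltRHS]splitr ltrD// hp.
Qed.

Lemma continuous_diff_quotient f v x h : continuous f -> h != 0 ->
  {for h, continuous (fun h => diff_quotient f v h x)}.
Proof.
move=> cf h0; rewrite /diff_quotient; apply: cvgM; first exact: cvgV.
apply: cvgB; last exact: cvg_cst.
have cg : (h' *: v + x) @[h' --> h] --> (h *: v + x).
  by apply: cvgD; [apply: cvgZl; exact: cvg_id|exact: cvg_cst].
by apply: (cvg_comp _ _ cg); exact: cf.
Qed.

(** For continuous f, an inequality between difference quotients at rational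
    steps extends to all nonzero steps by density. *)
Lemma rationally_derivableP f v x : continuous f ->
  derivable f x v <-> rationally_derivable f v x.
Proof.
move=> cf; split; first exact: derivable_rationally.
move=> gf; apply/cauchy_cvgP/cauchy_exP => e e0.
have [k ke] := exists_natinv_lt e0.
have [m hm] := gf k.
have m0 : 0 < m.+2%:R^-1 :> R by rewrite invr_gt0.
have [q q0 qm] : exists2 q : rat, q != 0 & `|ratr q : R| < m.+1%:R^-1.
  exists m.+2%:R^-1; first by rewrite invr_eq0 pnatr_eq0.
  rewrite fmorphV rmorph_nat ger0_norm ?invr_ge0//.
  by rewrite ltf_pV2 ?posrE// ltr_nat.
exists (diff_quotient f v (ratr q) x).
exists (m.+1%:R^-1) => /=; first by rewrite invr_gt0.
move=> h /=; rewrite sub0r normrN => hm1 h0.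
rewrite -ball_normE/=; apply: le_lt_trans ke; rewrite leNgt; apply/negP => abs.
(* A strict inequality at h would persist at a rational step close to h. *)
have cd : {for h, continuous (fun h => diff_quotient f v h x)}.
  exact: continuous_diff_quotient.
rewrite -[h^-1 *: _]/(diff_quotient f v h x) in abs.
have : \forall h' \near h, [/\ h' != 0, `|h'| < m.+1%:R^-1 &
    k.+1%:R^-1 < `|diff_quotient f v (ratr q) x - diff_quotient f v h' x| ].
  near=> h'; split; near: h'.
  - exact: (cvgr_neq0 _ (@cvg_id _ (nbhs h)) h0).
  - have : `|h'| @[h' --> h] --> `|h| by apply: cvg_norm; exact: cvg_id.
    by move/cvgr_lt; apply.
  - have : `|diff_quotient f v (ratr q) x - diff_quotient f v h' x| @[h' --> h]
      --> `|diff_quotient f v (ratr q) x - diff_quotient f v h x|.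
      by apply: cvg_norm; apply: cvgB => //; exact: cvg_cst.
    by move/cvgr_gt; apply.
move=> /nbhs_ballP[r /= r0 hr].
have [|y [/= hp [p _ pE]]] := @dense_rat R (ball h r) _ (ball_open h r).
  by exists h; exact: ballxx.
move: hp; rewrite -pE => /hr[p0 pm].
rewrite ltNge => /negP; apply; rewrite distrC; apply: (hm (p, q)).
by rewrite /rational_steps /= q0 pm qm !andbT; move: p0; rewrite fmorph_eq0.
Unshelve. all: by end_near. Qed.

Definition lipschitz_with (L : R) f := forall x y, `|f x - f y| <= L * `|x - y|.

Lemma lipschitz_with_continuous L f : lipschitz_with L f -> continuous f.
Proof.
move=> fL x; apply/cvgrPdist_lt => e e0.
have L0 : 0 < `|L| + 1 by rewrite ltr_wpDl.
near=> y; apply: le_lt_trans (fL _ _) _.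
apply: (@le_lt_trans _ _ ((`|L| + 1) * `|x - y|)).
  by rewrite ler_wpM2r// ler_wpDr// ler_norm.
rewrite -ltr_pdivlMl//; near: y.
by apply: cvgr_dist_lt; [exact: cvg_id|rewrite mulr_gt0// invr_gt0].
Unshelve. all: by end_near. Qed.

(** The value 0 at points without derivative makes this total function Borel
    for continuous f, and makes it depend on f only along the line through x,
    so that it is compatible with slicing. *)
Definition dir_derive f v x : R := if `[< derivable f x v >] then 'D_v f x else 0.

Lemma dir_deriveE f v x : derivable f x v -> dir_derive f v x = 'D_v f x.
Proof. by move=> d; rewrite /dir_derive asboolT. Qed.

Lemma is_derive_dir_derive f v x d : is_derive x v f d -> dir_derive f v x = d.
Proof. by move=> [fd <-]; rewrite dir_deriveE. Qed.

Lemma dir_derive_bound L f v x : lipschitz_with L f ->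
  `|dir_derive f v x| <= `|L| * `|v|.
Proof.
move=> fL; rewrite /dir_derive; case: asboolP => [fd|]; last first.
  by rewrite normr0 mulr_ge0.
have : `|h^-1 *: (f (h *: v + x) - f x)| @[h --> 0^'] --> `|'D_v f x|.
  by apply: cvg_norm.
move=> /cvgr_to_le; apply; near=> h.
have h0 : h != 0 by near: h; exact: nbhs_dnbhs_neq.
rewrite normrM normfV ler_pdivrMl ?normr_gt0//.
apply: (le_trans (fL _ _)); rewrite addrK normrZ [leRHS]mulrCA.
by rewrite ler_wpM2r ?mulr_ge0// ?ler_norm.
Unshelve. all: by end_near. Qed.

Lemma near_eq_dir_derive f g v x : (\near x, f x = g x) ->
  dir_derive f v x = dir_derive g v x.
Proof.
move=> fg; rewrite /dir_derive (near_eq_derive _ fg).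
have -> : derivable f x v = derivable g x v.
  apply: propext; split; apply: near_eq_derivable => //.
  by near=> y; apply/esym; near: y.
by [].
Unshelve. all: by end_near. Qed.

Lemma dir_derive_cst (c : R) v x : dir_derive (cst c) v x = 0.
Proof. exact: is_derive_dir_derive. Qed.

Lemma dir_derive_out M f v x : (forall y, M < `|y| -> f y = 0) -> M < `|x| ->
  dir_derive f v x = 0.
Proof.
move=> fM Mx; rewrite -(dir_derive_cst 0 v x); apply: near_eq_dir_derive.
near=> y; apply: fM; near: y.
have : `|y| @[y --> x] --> `|x| by apply: cvg_norm; exact: cvg_id.
by move/cvgr_gt; apply.
Unshelve. all: by end_near. Qed.

End derivability_set.

(** * Borel measurability of directional derivatives *)

Section borel.
Context {R : realType} {n : nat}.
Local Notation mu := (lebesgue_rV R n).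
Implicit Types (f : 'rV[R]_n -> R).

Lemma continuous_measurable_rV f : continuous f ->
  measurable_fun setT (f : _ -> measurableTypeR R).
Proof.
move=> cf; move=> mT; apply: (measurability _ (RGenOInfty.measurableE R)) => //.
move=> _ [_ [x ->] <-]; rewrite setTI preimage_itvoy; apply: open_measurable_rV.
rewrite (_ : [set _ | _] = f @^-1` [set y | x < y])//.
by apply: open_comp; [move=> ? _; exact: cf|exact: open_gt].
Qed.

Lemma measurable_diff_quotient f v h : continuous f ->
  measurable_fun setT (diff_quotient f v h : _ -> measurableTypeR R).
Proof.
move=> cf; apply: (@measurable_funM _ _ _ _ (cst h^-1)
  (fun x => f (h *: v + x) - f x)); first exact: measurable_cst.
apply: measurable_funB.
  apply: continuous_measurable_rV => x.
  have cg : (h *: v + y) @[y --> x] --> (h *: v + x).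
    by apply: (@cvgD _ _ _ (nbhs x) _ (cst (h *: v)) id); [exact: cvg_cst|exact: cvg_id].
  by apply: (cvg_comp _ _ cg); exact: cf.
exact: continuous_measurable_rV.
Qed.

Lemma measurable_derivable f v : continuous f ->
  measurable [set x | derivable f x v].
Proof.
move=> cf.
pose D k (pq : rat * rat) := [set x : 'rV[R]_n |
  `|diff_quotient f v (ratr pq.1) x - diff_quotient f v (ratr pq.2) x|
    <= k.+1%:R^-1].
have mD k pq : measurable (D k pq).
  rewrite -[X in measurable X]setTI.
  apply: measurable_fun_le => //.
  by apply: measurableT_comp => //; apply: measurable_funB;
    exact: measurable_diff_quotient.
rewrite (_ : mkset _ = \bigcap_k \bigcup_m
   ~` \bigcup_(pq in [set pq | @rational_steps R m pq]) ~` D k pq).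
  apply: bigcapT_measurable => k; apply: bigcupT_measurable => m.
  apply: measurableC; rewrite bigcup_mkcond.
  apply: countable_bigcupT_measurable => [|pq]; first exact: countableP.
  by case: ifP => // _; exact: measurableC.
apply/seteqP; split => x /=.
  move=> /derivable_rationally xf k _; have [m mk] := xf k.
  by exists m => // -[pq /= /mk].
move=> H; apply/rationally_derivableP => // k.
have [m _ /= mk] := H k I; exists m => pq pqm.
by apply: contrapT => abs; apply: mk; exists pq.
Qed.

(** On the Borel set of derivability it is a limit of difference quotients. *)
Lemma measurable_dir_derive f v : continuous f ->
  measurable_fun setT (dir_derive f v : _ -> measurableTypeR R).
Proof.
move=> cf; pose D := [set x | derivable f x v].
have mD : measurable D by exact: measurable_derivable.
have -> : dir_derive f v = (fun x => 'D_v f x) \_ D.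
  apply/funext => x; rewrite patchE /dir_derive.
  by congr (if _ then _ else _); apply/idP/idP; rewrite inE => /asboolP.
apply/(measurable_restrictT _ mD).
pose h m : R := m.+1%:R^-1.
apply: (@measurable_fun_cvg _ _ _ D (fun m => diff_quotient f v (h m))).
  by move=> m; apply: measurable_funTS; exact: measurable_diff_quotient.
move=> x Dx.
have : diff_quotient f v h x @[h --> 0^'] --> 'D_v f x by exact: Dx.
move=> /cvgrPdist_lt fx; apply/cvgrPdist_lt => e /fx[/= r r0 hr].
near=> m; apply: hr; last by rewrite invr_eq0 pnatr_eq0.
rewrite /= sub0r normrN ger0_norm ?invr_ge0//; near: m.
exact: (near_infty_natSinv_lt (PosNum r0)).
Unshelve. all: by end_near. Qed.
End borel.

(** * Cubes and bounded functions with bounded support *)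

Section box.
Context {R : realType} {n : nat}.
Local Notation mu := (lebesgue_rV R n).
Implicit Types (f : 'rV[R]_n -> R).

Lemma rV_norm_leP (x : 'rV[R]_n) (M : R) : 0 <= M ->
  `|x| <= M <-> forall i, `|x ord0 i| <= M.
Proof.
move=> M0; rewrite /Num.Def.normr/= mx_normrE; split => [h i|h].
  by apply: le_trans h; rewrite (le_bigmax _ _ (ord0, i)).
by apply: bigmax_le => // -[i j] _; rewrite ord1; exact: h.
Qed.

Lemma coord_le_norm (x : 'rV[R]_n) i : `|x ord0 i| <= `|x|.
Proof. exact: (rV_norm_leP _ (normr_ge0 x)).1. Qed.

Definition box (M : R) : set 'rV[R]_n := [set x | `|x| <= M].

Lemma measurable_box M : measurable (box M).
Proof.
rewrite -[X in measurable X]setCK; apply: measurableC; apply: open_measurable_rV.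
apply: closed_openC.
apply: (@closed_comp _ _ (fun x : 'rV[R]_n => `|x|) [set x | x <= M]).
  by move=> x _; exact: norm_continuous.
exact: closed_le.
Qed.

Lemma box_lty M : (mu (box M) < +oo)%E.
Proof.
have M0 : 0 <= `|M| by [].
apply: (@le_lt_trans _ _ (mu (box `|M|))).
  apply: le_measure; rewrite ?inE; [exact: measurable_box..|].
  by move=> x /= /le_trans; apply; exact: ler_norm.
have -> : box `|M| = [set x : 'rV[R]_n | forall i,
    x ord0 i \in `[(const_mx (- `|M|) : 'rV[R]_n) ord0 i,
                   (const_mx `|M| : 'rV[R]_n) ord0 i]%R].
  apply/seteqP; split => x /=.
    by move=> /(rV_norm_leP _ M0) h i; rewrite in_itv/= !mxE -ler_norml.
  move=> h; apply/(rV_norm_leP _ M0) => i; have := h i.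
  by rewrite in_itv/= !mxE -ler_norml.
rewrite lebesgue_rV_box ?ltry// => i; rewrite !mxE.
by rewrite (@le_trans _ _ 0)// oppr_le0.
Qed.

(** Cubes have finite measure. *)
Lemma integrable_bounded_support f C M :
  measurable_fun setT (f : _ -> measurableTypeR R) ->
  (forall x, `|f x| <= C) -> (forall x, M < `|x| -> f x = 0) ->
  mu.-integrable setT (EFin \o f).
Proof.
move=> mf fC fM.
have -> : f = f \_ (box M).
  apply/funext => x; rewrite patchE; case: ifPn => //.
  by rewrite notin_setE /box/= => /negP; rewrite -ltNge => /fM.
rewrite -restrict_EFin; apply/(integrable_mkcond _ (measurable_box M)).
apply: measurable_bounded_integrable.
- exact: measurable_box.
- exact: box_lty.
- exact: measurable_funTS.
- by exists C; split; [rewrite num_real|move=> y /ltW Cy x _; exact: le_trans Cy].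
Qed.

End box.

(** * Integration by slices *)

Section slices.
Context {R : realType} {n : nat}.
Local Notation mu := (lebesgue_rV R n).
Local Notation muS := (lebesgue_rV R n.+1).
Local Notation leb := (@lebesgue_measure R).
Local Notation prod := (leb \x mu)%E.

(** In dimension n.+1 Lebesgue measure is by construction the image of a product
    measure under row_cons; these lemmas transport Fubini through it. *)
Lemma integrable_row_cons (g : 'rV[R]_n.+1 -> \bar R) :
  muS.-integrable setT g -> prod.-integrable setT (g \o @row_cons R n).
Proof.
move=> /integrableP[mg ig]; apply/integrableP; split.
  exact: measurableT_comp (@measurable_row_cons R n).
apply: le_lt_trans ig.
rewrite [leRHS](@ge0_integral_pushforward _ _ _ _ _ _
  (@measurable_row_cons R n) prod setT (abse \o g))//.
  by apply: measurableT_comp.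
by move=> y _; exact: abse_ge0.
Qed.

Lemma integral_row_cons (g : 'rV[R]_n.+1 -> \bar R) :
  muS.-integrable setT g ->
  (\int[muS]_x g x = \int[prod]_p g (row_cons p))%E.
Proof.
move=> ig; have [mg _] := integrableP _ _ _ ig.
exact: (@integral_pushforward _ _ _ _ _ _ (@measurable_row_cons R n) prod setT
  g mg (integrable_row_cons ig)).
Qed.

Lemma integral_slices0 (g : 'rV[R]_n.+1 -> \bar R) :
  muS.-integrable setT g ->
  (forall y, \int[leb]_s g (row_cons (s, y)) = 0)%E ->
  (\int[muS]_x g x = 0)%E.
Proof.
move=> ig g0; rewrite integral_row_cons//.
rewrite -(integral21_prod_meas1 (integrable_row_cons ig))/fubini_G/=.
by apply: integral0_eq => y _; exact: g0.
Qed.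

Lemma integral_slicesS (g : 'rV[R]_n.+1 -> \bar R) :
  muS.-integrable setT g ->
  (forall s, \int[mu]_y g (row_cons (s, y)) = 0)%E ->
  (\int[muS]_x g x = 0)%E.
Proof.
move=> ig g0; rewrite integral_row_cons//.
rewrite -(integral12_prod_meas1 (integrable_row_cons ig))/fubini_F/=.
by apply: integral0_eq => y _; exact: g0.
Qed.

Lemma null_slicesS (A : set 'rV[R]_n.+1) : measurable A ->
  (forall s, mu [set y | A (row_cons (s, y))] = 0)%E -> muS A = 0%E.
Proof.
move=> mA A0; rewrite /=/lebesgue_cons/pushforward/product_measure1.
apply: integral0_eq => s _ /=; rewrite -[RHS](A0 s).
by congr (mu _); apply/seteqP; split => y /=; rewrite /xsection/= inE.
Qed.

Lemma null_slices0 (A : set 'rV[R]_n.+1) : measurable A ->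
  (forall y, leb [set s | A (row_cons (s, y))] = 0)%E -> muS A = 0%E.
Proof.
move=> mA A0.
have mB : measurable (@row_cons R n @^-1` A).
  by rewrite -[X in measurable X]setTI; exact: measurable_row_cons.
apply: (@etrans _ _ (prod (@row_cons R n @^-1` A))) => //.
have := indic_fubini_tonelli1 leb mu mB.
rewrite integral_indic// setIT => ->.
rewrite indic_fubini_tonelli// indic_fubini_tonelli_GE//.
apply: integral0_eq => y _ /=; rewrite -[RHS](A0 y).
by congr (leb _); apply/seteqP; split => s /=; rewrite /ysection/= inE.
Qed.

End slices.

(** * Rademacher theorem for partial derivatives *)

(** Derivability only looks at the line through the point, which identifies
    derivatives of f with derivatives of its slices. *)
Lemma eq_line_dir_derive (R : realType) (V W : normedModType R)
    (f : V -> R) (g : W -> R) v w x y :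
  (forall h : R, f (h *: v + x) = g (h *: w + y)) ->
  (derivable f x v <-> derivable g y w) /\ dir_derive f v x = dir_derive g w y.
Proof.
move=> fg.
have fgE : (fun h : R => h^-1 *: ((f \o shift x) (h *: v) - f x)) =
           (fun h : R => h^-1 *: ((g \o shift y) (h *: w) - g y)).
  apply/funext => h /=; rewrite fg.
  by have := fg 0; rewrite !scale0r !add0r => ->.
have dE : derivable f x v = derivable g y w by rewrite /derivable fgE.
by rewrite /dir_derive /derive dE fgE.
Qed.

Section row_cons_linear.
Context {R : realType} {n : nat}.

Lemma row_cons_shift0 (h s : R) (y : 'rV[R]_n) :
  h *: delta_mx ord0 ord0 + row_cons (s, y) = row_cons (h *: 1 + s : R, y).
Proof.
move: (@row_cons0 R n) (@row_consS R n); move: (@row_cons R n) => rc rc0 rcS.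
apply/rowP => i; rewrite !mxE; case: (unliftP ord0 i) => [j|] ->.
  by rewrite !rcS/= mulr0 add0r.
by rewrite !rc0/=.
Qed.

Lemma row_cons_shiftS (h s : R) (y : 'rV[R]_n) j :
  h *: delta_mx ord0 (lift ord0 j) + row_cons (s, y) =
  row_cons (s, h *: delta_mx ord0 j + y).
Proof.
move: (@row_cons0 R n) (@row_consS R n); move: (@row_cons R n) => rc rc0 rcS.
apply/rowP => i; rewrite !mxE; case: (unliftP ord0 i) => [k|] ->.
  by rewrite !rcS/= !mxE (inj_eq lift_inj).
by rewrite !rc0/= mulr0 add0r.
Qed.

Lemma row_cons_normB (s t : R) (y z : 'rV[R]_n) :
  `|row_cons (s, y) - row_cons (t, z)| <= Num.max `|s - t| `|y - z|.
Proof.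
move: (@row_cons0 R n) (@row_consS R n); move: (@row_cons R n) => rc rc0 rcS.
apply/rV_norm_leP => [|i]; first by rewrite le_max normr_ge0.
rewrite !mxE; case: (unliftP ord0 i) => [k|] ->.
  rewrite !rcS/= le_max; apply/orP; right.
  by have := coord_le_norm (y - z) k; rewrite !mxE.
by rewrite !rc0/= le_max lexx.
Qed.

Lemma row_cons_norm0 (s : R) (y : 'rV[R]_n) : `|s| <= `|row_cons (s, y)|.
Proof. by have := coord_le_norm (row_cons (s, y)) ord0; rewrite row_cons0. Qed.

Lemma row_cons_normS (s : R) (y : 'rV[R]_n) : `|y| <= `|row_cons (s, y)|.
Proof.
apply/rV_norm_leP => // i.
by have := coord_le_norm (row_cons (s, y)) (lift ord0 i); rewrite row_consS.
Qed.

End row_cons_linear.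

Section rademacher.
Context {R : realType}.
Local Notation leb := (@lebesgue_measure R).

Lemma integrable_dir_derive n (f : 'rV[R]_n -> R) L M v : lipschitz_with L f ->
  (forall x, M < `|x| -> f x = 0) ->
  (lebesgue_rV R n).-integrable setT (EFin \o dir_derive f v).
Proof.
move=> fL fM; apply: integrable_bounded_support.
- exact: measurable_dir_derive (lipschitz_with_continuous fL).
- by move=> x; exact: dir_derive_bound fL.
- by move=> x; exact: dir_derive_out fM.
Qed.

(** The bad set is Borel and its slices in the direction of differentiation are
    null, by the one-dimensional result for the first coordinate and by
    induction for the others; the integral is treated in the same way. *)
Theorem rademacher n (f : 'rV[R]_n -> R) (L M : R) (i : 'I_n) :
  0 < L -> 0 < M -> lipschitz_with L f -> (forall x, M <= `|x| -> f x = 0) ->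
  lebesgue_rV R n [set x | ~ derivable f x (delta_mx ord0 i)] = 0%E /\
  (\int[lebesgue_rV R n]_x (dir_derive f (delta_mx ord0 i) x)%:E = 0)%E.
Proof.
elim: n f i => [f []//|n IHn] f i L0 M0 fL fM.
have fc := lipschitz_with_continuous fL.
have fM' x : M < `|x| -> f x = 0 by move=> /ltW; exact: fM.
have mA : measurable [set x | ~ derivable f x (delta_mx ord0 i)].
  exact: measurableC (measurable_derivable _ fc).
have intf := integrable_dir_derive (delta_mx ord0 i) fL fM'.
case: (unliftP ord0 i) mA intf => [j|] ->{i} mA intf.
- pose g s y := f (row_cons (s, y)).
  have lineE s y := @eq_line_dir_derive _ _ _ f (g s) (delta_mx ord0 (lift ord0 j))
    (delta_mx ord0 j) (row_cons (s, y)) y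
    (fun h => congr1 f (row_cons_shiftS h s y j)).
  have gL s : lipschitz_with L (g s).
    move=> y z; apply: (le_trans (fL _ _)).
    rewrite ler_pM2l// (le_trans (row_cons_normB _ _ _ _))//.
    by rewrite subrr normr0 max_r.
  have gM s y : M <= `|y| -> g s y = 0.
    by move=> My; apply: fM; exact: le_trans (row_cons_normS _ _).
  have IH s := IHn (g s) j L0 M0 (gL s) (gM s).
  split.
    apply: null_slicesS => // s.
    have -> : [set y | [set x | ~ derivable f x (delta_mx ord0 (lift ord0 j))]
          (row_cons (s, y))] =
        [set y | ~ derivable (g s) y (delta_mx ord0 j)].
      apply/seteqP; split => y /= h1 h2; apply: h1.
        exact: ((lineE s y).1.2 h2).
      exact: ((lineE s y).1.1 h2).
    exact: (IH s).1.
  apply: integral_slicesS => // s; rewrite -[RHS](IH s).2.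
  by apply: eq_integral => y _ /=; rewrite (lineE s y).2.
- pose g y (s : R) := f (row_cons (s, y)).
  have lineE s y := @eq_line_dir_derive _ _ R f (g y) (delta_mx ord0 ord0)
    1 (row_cons (s, y)) s
    (fun h => congr1 f (row_cons_shift0 h s y)).
  have gL y (s t : R) : `|g y s - g y t| <= L * `|s - t|.
    apply: (le_trans (fL _ _)).
    rewrite ler_pM2l// (le_trans (row_cons_normB _ _ _ _))//.
    by rewrite subrr normr0 max_l.
  have gM y s : M <= `|s| -> g y s = 0.
    by move=> My; apply: fM; exact: le_trans (row_cons_norm0 _ _).
  have line y := lipschitz_line_derivative L0 M0 (gL y) (gM y).
  split.
    apply: null_slices0 => // y; have [d [_ _ dy]] := line y.
    apply: measure_negligible.
      rewrite -[X in measurable X]setTI;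
      apply: (_ : measurable_fun setT (fun s => row_cons (s, y))) => //.
      exact: measurableT_comp (@measurable_row_cons R n) (measurable_pair2 y).
    apply: negligibleS dy => s /= h ds; apply: h; apply/(lineE s y).1.
    exact: (@ex_derive _ _ _ _ _ _ _ ds).
  apply: integral_slices0 => // y; have [d [id d0 dy]] := line y.
  have -> : (\int[leb]_s (dir_derive f (delta_mx ord0 ord0) (row_cons (s, y)))%:E
     = \int[leb]_s (d s)%:E)%E.
    apply: ae_eq_integral => //.
    - have mf := @measurable_dir_derive R n.+1 f (delta_mx ord0 ord0) fc.
      apply/measurable_EFinP.
      exact: measurableT_comp mf
        (measurableT_comp (@measurable_row_cons R n) (measurable_pair2 y)).
    - by have [] := integrableP _ _ _ id.
    - apply: filterS dy; first exact: (ae_filter_ringOfSetsType leb).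
      move=> s ds _ /=; congr EFin.
      by rewrite (lineE s y).2; exact: is_derive_dir_derive.
  rewrite -[LHS]fineK; last exact: integrable_fin_num.
  by congr EFin.
Qed.

End rademacher.

(** * Integrals of functions that agree almost everywhere *)

Section ae_integral.
Context d (T : measurableType d) (R : realType) (mu : {measure set T -> \bar R}).
Local Open Scope ereal_scope.
Import HBNNSimple.

Let ge0_ae_le (f g : T -> \bar R) :
  (forall x, 0 <= f x) -> (forall x, 0 <= g x) ->
  {ae mu, forall x, f x = g x} -> \int[mu]_x f x <= \int[mu]_x g x.
Proof.
move=> f0 g0 [N [mN N0 fgN]]; have mNC := measurableC mN.
rewrite !ge0_integralTE//; apply: ge_ereal_sup => _ [h /= hf <-].
apply: ereal_sup_ubound => /=; exists (proj_nnsfun h mNC) => [x|].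
  rewrite -mrestrict patchE; case: ifPn => // xN.
  rewrite (_ : g x = f x)//; apply: contrapT => gf.
  by move: xN; rewrite inE => -[]; apply: fgN => /= /esym.
rewrite -!integralT_nnsfun; apply: ge0_ae_eq_integral => //.
- by apply/measurable_EFinP.
- by apply/measurable_EFinP.
- by move=> x _; rewrite lee_fin fun_ge0.
- by move=> x _; rewrite lee_fin fun_ge0.
exists N; split => // x /= hx; apply: contrapT => Nx; apply: hx => _.
by congr EFin; rewrite mindicE mem_set ?mulr1.
Qed.

(** The integral is a supremum over simple functions below the integrand, and
    these can be set to 0 on a null set at no cost, so that the identity holds
    for arbitrary functions.  This allows the potential and the gradient, only
    known to be measurable up to a null set, to be replaced by Borel
    representatives. *)
Lemma ae_integral_eq (f g : T -> \bar R) :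
  {ae mu, forall x, f x = g x} -> \int[mu]_x f x = \int[mu]_x g x.
Proof.
have ge0_case (u v : T -> \bar R) : (forall x, 0 <= u x) ->
    (forall x, 0 <= v x) -> {ae mu, forall x, u x = v x} ->
    \int[mu]_x u x = \int[mu]_x v x.
  move=> u0 v0 uv; apply/eqP; rewrite eq_le !ge0_ae_le//.
  by apply: filterS uv => x ->.
move=> fg; rewrite integralE [RHS]integralE; congr (_ - _).
  by apply: ge0_case => //; apply: filterS fg => x xE; rewrite !funeposE xE.
by apply: ge0_case => //; apply: filterS fg => x xE; rewrite !funenegE xE.
Qed.

End ae_integral.

(** * Bounded Lipschitz functions and bumps *)

Section bounded_lipschitz.
Context {R : realType} {V : normedModType R}.
Implicit Types (f g : V -> R).

Definition bounded_lipschitz f := exists L C : R,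
  [/\ 0 < L, lipschitz_with L f & forall x, `|f x| <= C].

Lemma bounded_lipschitz_continuous f : bounded_lipschitz f -> continuous f.
Proof. by move=> [L [C [_ + _]]]; exact: lipschitz_with_continuous. Qed.

Lemma bounded_lipschitz_cst (c : R) : bounded_lipschitz (cst c).
Proof.
exists 1, `|c|; split => // x y /=; by rewrite subrr normr0 mul1r.
Qed.

Lemma bounded_lipschitzD f g : bounded_lipschitz f -> bounded_lipschitz g ->
  bounded_lipschitz (fun x => f x + g x).
Proof.
move=> [L [C [L0 fL fC]]] [L' [C' [L'0 gL gC]]].
exists (L + L'), (C + C'); split; first exact: addr_gt0.
  move=> x y; rewrite opprD addrACA mulrDl.
  by apply: (le_trans (ler_normD _ _)); apply: lerD; [exact: fL|exact: gL].
by move=> x; apply: (le_trans (ler_normD _ _)); exact: lerD.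
Qed.

Lemma bounded_lipschitzM f g : bounded_lipschitz f -> bounded_lipschitz g ->
  bounded_lipschitz (fun x => f x * g x).
Proof.
move=> [L [C [L0 fL fC]]] [L' [C' [L'0 gL gC]]].
have C0 : 0 <= C by exact: le_trans (fC 0).
have C'0 : 0 <= C' by exact: le_trans (gC 0).
exists (L * C' + C * L' + 1), (C * C'); split.
- by rewrite ltr_wpDl// addr_ge0// mulr_ge0// ltW.
- move=> x y.
  have -> : f x * g x - f y * g y = (f x - f y) * g x + f y * (g x - g y) by ring.
  apply: (le_trans (ler_normD _ _)); rewrite !normrM.
  have h1 : `|f x - f y| * `|g x| <= (L * `|x - y|) * C' by rewrite ler_pM.
  have h2 : `|f y| * `|g x - g y| <= C * (L' * `|x - y|) by rewrite ler_pM.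
  have h3 : 0 <= `|x - y| by [].
  by move: h1 h2 h3; nra.
- by move=> x; rewrite normrM ler_pM.
Qed.

Lemma bounded_lipschitz_comp f (u : R -> R) :
  (forall s t, `|u s - u t| <= `|s - t|) -> (forall s, `|u s| <= `|s|) ->
  bounded_lipschitz f -> bounded_lipschitz (u \o f).
Proof.
move=> uL u0 [L [C [L0 fL fC]]]; exists L, C; split => //.
  by move=> x y; exact: le_trans (uL _ _) (fL _ _).
by move=> x; exact: le_trans (u0 _) (fC _).
Qed.

Lemma bounded_lipschitz_norm f : bounded_lipschitz f ->
  bounded_lipschitz (fun x => `|f x|).
Proof.
apply: (@bounded_lipschitz_comp _ Num.norm) => [s t|s].
  exact: ler_dist_dist.
by rewrite normr_id.
Qed.

Lemma bounded_lipschitz_pos f : bounded_lipschitz f ->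
  bounded_lipschitz (fun x => Num.max 0 (f x)).
Proof.
apply: (@bounded_lipschitz_comp _ (Num.max 0)) => [s t|s].
  exact: ler_dist_max.
by case: (leP 0 s) => // ?; rewrite normr0.
Qed.

Lemma bounded_lipschitz_sum I (r : seq I) (F : I -> V -> R) :
  (forall i, bounded_lipschitz (F i)) ->
  bounded_lipschitz (fun x => \sum_(i <- r) F i x).
Proof.
move=> FL; elim: r => [|i r IH].
  rewrite (_ : (fun _ => _) = cst 0); first exact: bounded_lipschitz_cst.
  by apply/funext => x; rewrite big_nil.
rewrite (_ : (fun _ => _) = (fun x => F i x + \sum_(j <- r) F j x)).
  exact: bounded_lipschitzD.
by apply/funext => x; rewrite big_cons.
Qed.

Lemma bounded_support_bounded_lipschitz f L M : 0 < L -> lipschitz_with L f ->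
  (forall x, M <= `|x| -> f x = 0) -> bounded_lipschitz f.
Proof.
move=> L0 fL fM; exists L, (`|f 0| + L * `|M|); split => // x.
have [Mx|xM] := leP M `|x|.
  by rewrite fM// normr0; apply: addr_ge0 => //; apply: mulr_ge0 => //; exact: ltW.
rewrite -[f x](subrK (f 0)) addrC; apply: (le_trans (ler_normD _ _)).
rewrite lerD2l; apply: (le_trans (fL _ _)); rewrite subr0 ler_pM2l//.
by rewrite (le_trans (ltW xM))// ler_norm.
Qed.

End bounded_lipschitz.

Section bump.
Context {R : realType} {n : nat}.
Variables (a : 'rV[R]_n) (r : R).
Hypothesis r0 : 0 < r.

(** Clipping the coordinates does not change cap and makes it a composition of
    bounded Lipschitz functions, although sqd is not Lipschitz. *)
Let clip (t : R) := Num.max (- r) (Num.min t r).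
Let sqd (x : 'rV[R]_n) := \sum_(i < n) (x ord0 i - a ord0 i) ^+ 2.

Definition cap (x : 'rV[R]_n) : R := Num.max 0 (r ^+ 2 - sqd x).

Let clipE t : - r <= t -> t <= r -> clip t = t.
Proof. by move=> rt tr; rewrite /clip min_l// max_r. Qed.

Let clip_sqr t : r < `|t| -> clip t ^+ 2 = r ^+ 2.
Proof.
have r0' := r0; rewrite /clip lter_normr => /orP[rt|rt].
  by rewrite min_r ?ltW// max_r//; lra.
by rewrite min_l ?max_l ?sqrrN//; lra.
Qed.

Let cap_out (x : 'rV[R]_n) i : r <= `|x ord0 i - a ord0 i| -> cap x = 0.
Proof.
move=> h; rewrite /cap max_l// subr_le0 /sqd (bigD1 i)//= ler_wpDr//.
  by rewrite sumr_ge0// => j _; exact: sqr_ge0.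
by rewrite -(real_normK (num_real (x ord0 i - _))) ler_pXn2r ?nnegrE// ltW.
Qed.

Let clip_blip i : bounded_lipschitz (fun x : 'rV[R]_n => clip (x ord0 i - a ord0 i)).
Proof.
have clip_le s t : `|clip s - clip t| <= `|s - t|.
  exact: le_trans (ler_dist_max _ _ _) (ler_dist_min _ _ _).
exists 1, r; split => //.
  move=> x y; rewrite mul1r; apply: (le_trans (clip_le _ _)).
  rewrite opprD addrACA opprK addNr addr0.
  by have := coord_le_norm (x - y) i; rewrite !mxE.
move=> x; rewrite /clip ler_norml le_max lexx/= ge_max ge_min lexx orbT andbT.
by rewrite ge0_cp// ltW.
Qed.

Let cap_clip (x : 'rV[R]_n) : cap x =
  Num.max 0 (r ^+ 2 - \sum_(i < n) clip (x ord0 i - a ord0 i) ^+ 2).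
Proof.
have [[i xi]|h] := pselect (exists i, r < `|x ord0 i - a ord0 i|).
  rewrite (cap_out (ltW xi)) max_l// subr_le0 (bigD1 i)//= clip_sqr//.
  by rewrite lerDl sumr_ge0// => j _; exact: sqr_ge0.
rewrite /cap /sqd; congr (Num.max 0 (_ - _)); apply: eq_bigr => i _.
have : `|x ord0 i - a ord0 i| <= r.
  by rewrite leNgt; apply/negP => ?; apply: h; exists i.
by rewrite ler_norml => /andP[? ?]; rewrite clipE.
Qed.

Let cap_blip : bounded_lipschitz cap.
Proof.
rewrite (_ : cap = fun x => Num.max 0 (r ^+ 2 +
    (-1) * \sum_(i < n) clip (x ord0 i - a ord0 i) * clip (x ord0 i - a ord0 i))).
  apply: bounded_lipschitz_pos; apply: bounded_lipschitzD.
    exact: bounded_lipschitz_cst.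
  apply: bounded_lipschitzM; first exact: bounded_lipschitz_cst.
  by apply: bounded_lipschitz_sum => i; apply: bounded_lipschitzM.
by apply/funext => x; rewrite cap_clip mulN1r.
Qed.

(** Squaring makes the cap differentiable with Lipschitz derivatives. *)
Definition bump (x : 'rV[R]_n) : R := cap x ^+ 2.

Definition bump_deriv (i : 'I_n) (x : 'rV[R]_n) : R :=
  - 4 * ((x ord0 i - a ord0 i) * cap x).

Lemma bump_bounded_lipschitz : bounded_lipschitz bump.
Proof. exact: bounded_lipschitzM. Qed.

Lemma bump_deriv_bounded_lipschitz i : bounded_lipschitz (bump_deriv i).
Proof.
rewrite (_ : bump_deriv i = fun x => -4 * (clip (x ord0 i - a ord0 i) * cap x)).
  apply: bounded_lipschitzM; first exact: bounded_lipschitz_cst.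
  exact: bounded_lipschitzM.
apply/funext => x; rewrite /bump_deriv; congr (_ * _).
have [h|h] := leP r `|x ord0 i - a ord0 i|; first by rewrite (cap_out h) !mulr0.
by move: h; rewrite ltr_norml => /andP[/ltW ? /ltW ?]; rewrite clipE.
Qed.

Lemma cap_out_ball (x : 'rV[R]_n) : r < `|x - a| -> cap x = 0.
Proof.
move=> h; have [[i /ltW xi]|abs] := pselect (exists i, r < `|x ord0 i - a ord0 i|).
  exact: cap_out xi.
move: h; rewrite ltNge => /negP; case; apply/rV_norm_leP; first exact: ltW.
by move=> i; rewrite !mxE leNgt; apply/negP => ?; apply: abs; exists i.
Qed.

Lemma bump_out (x : 'rV[R]_n) : r < `|x - a| -> bump x = 0.
Proof. by move=> /cap_out_ball; rewrite /bump => ->; rewrite expr0n. Qed.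

Lemma bump_deriv_out i (x : 'rV[R]_n) : r < `|x - a| -> bump_deriv i x = 0.
Proof. by move=> /cap_out_ball; rewrite /bump_deriv => ->; rewrite !mulr0. Qed.

Lemma bump_ge0 x : 0 <= bump x. Proof. exact: sqr_ge0. Qed.

Lemma bump_center : 0 < bump a.
Proof.
rewrite /bump /cap /sqd big1 => [|i _]; last by rewrite subrr expr0n.
by rewrite subr0 max_r ?sqr_ge0// !exprn_gt0.
Qed.

(** The second-order Taylor estimate for the square of the positive part, from
    which the derivative of bump is read off directly. *)
Let pos_sqr (s e : R) :
  `|Num.max 0 (s + e) ^+ 2 - Num.max 0 s ^+ 2 - 2 * e * Num.max 0 s| <= e ^+ 2.
Proof.
rewrite ler_norml; case: (leP 0 s) => ?; case: (leP 0 (s + e)) => ?;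
  apply/andP; split; nra.
Qed.

Lemma is_derive_bump i x : is_derive x (delta_mx ord0 i) bump (bump_deriv i x).
Proof.
set v := delta_mx ord0 i; set t := x ord0 i - a ord0 i.
have sqdE h : sqd (h *: v + x) = sqd x + 2 * h * t + h ^+ 2.
  rewrite /sqd (bigD1 i)//= [in RHS](bigD1 i)//= !mxE !eqxx mulr1.
  rewrite (eq_bigr (fun j => (x ord0 j - a ord0 j) ^+ 2)); last first.
    by move=> j ji; rewrite !mxE (negbTE ji) andbF mulr0 add0r.
  by rewrite -/t; set u := \sum_(_ | _) _; rewrite /t; ring.
pose C := (2 * `|t| + 1) ^+ 2 + 2 * cap x.
have cap0 : 0 <= cap x by rewrite /cap le_max lexx.
have C0 : 0 < C by rewrite /C ltr_pwDl ?mulr_ge0// exprn_gt0// ltr_wpDl.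
have rem h : `|h| <= 1 ->
    `|bump (h *: v + x) - bump x - h * bump_deriv i x| <= C * h ^+ 2.
  move=> h1; pose e := - 2 * h * t - h ^+ 2.
  have -> : bump (h *: v + x) - bump x - h * bump_deriv i x =
      (Num.max 0 (r ^+ 2 - sqd x + e) ^+ 2 - Num.max 0 (r ^+ 2 - sqd x) ^+ 2
        - 2 * e * Num.max 0 (r ^+ 2 - sqd x)) - 2 * cap x * h ^+ 2.
    rewrite /bump {1}/cap sqdE /bump_deriv -/t.
    rewrite (_ : r ^+ 2 - (sqd x + 2 * h * t + h ^+ 2) = r ^+ 2 - sqd x + e);
      last by rewrite /e; ring.
    by rewrite /cap /e; ring.
  apply: (le_trans (ler_normB _ _)).
  rewrite [in X in _ + X]ger0_norm; last first.
    by apply: mulr_ge0; [exact: mulr_ge0|exact: sqr_ge0].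
  rewrite /C [leRHS]mulrDl lerD2r; apply: (le_trans (pos_sqr _ _)).
  have -> : e = - ((2 * t + h) * h) by rewrite /e; ring.
  rewrite sqrrN exprMn ler_wpM2r ?sqr_ge0//.
  have th : `|2 * t + h| <= 2 * `|t| + 1.
    by rewrite (le_trans (ler_normD _ _))// normrM (ger0_norm (_ : 0 <= 2))// lerD2l.
  rewrite -(real_normK (num_real (2 * t + h))) ler_pXn2r// nnegrE.
  exact: le_trans th.
have dcvg : (h^-1 *: ((bump \o shift x) (h *: v) - bump x)) @[h --> 0^'] -->
    bump_deriv i x.
  apply/cvgrPdist_le => e e0; near=> h.
  have h0 : h != 0 by near: h; exact: nbhs_dnbhs_neq.
  have h1 : `|h| <= 1 by near: h; apply: dnbhs0_le.
  have he : `|h| <= e / C by near: h; apply: dnbhs0_le; rewrite divr_gt0.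
  rewrite distrC -(ler_pM2l (_ : 0 < `|h|)) ?normr_gt0// -normrM mulrBr.
  rewrite /GRing.scale/= mulVKf//; apply: (le_trans (rem _ h1)).
  rewrite -(real_normK (num_real h)) expr2 mulrCA ler_wpM2l//.
  by rewrite -ler_pdivlMl// mulrC.
split; last exact: cvg_lim dcvg.
by apply/cvg_ex; exists (bump_deriv i x).
Unshelve. all: by end_near. Qed.

End bump.

(** * Integration by parts for test functions *)

Section Rintegral_lemmas.
Context d (T : measurableType d) (R : realType) (mu : {measure set T -> \bar R}).
Implicit Types f g : T -> R.

Lemma integrable_EFinD f g : mu.-integrable setT (EFin \o f) ->
  mu.-integrable setT (EFin \o g) ->
  mu.-integrable setT (EFin \o (fun x => f x + g x)).
Proof. by move=> fi gi; exact: (integrableD measurableT fi gi). Qed.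

Lemma integrable_EFinZ (c : R) f : mu.-integrable setT (EFin \o f) ->
  mu.-integrable setT (EFin \o (fun x => c * f x)).
Proof. by move=> fi; exact: (integrableZl measurableT c fi). Qed.

Lemma Rintegral_sum (I : Type) (s : seq I) (F : I -> T -> R) :
  (forall i, mu.-integrable setT (EFin \o F i)) ->
  mu.-integrable setT (EFin \o (fun x => \sum_(i <- s) F i x)) /\
  \int[mu]_x (\sum_(i <- s) F i x) = \sum_(i <- s) \int[mu]_x F i x.
Proof.
move=> Fi; elim: s => [|i s [IHi IH]].
  rewrite (_ : (fun _ => _) = cst 0); last by apply/funext => x; rewrite big_nil.
  by split; [exact: integrable0|rewrite big_nil /Rintegral integral0].
rewrite (_ : (fun _ => _) = (fun x => F i x + \sum_(j <- s) F j x)); last first.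
  by apply/funext => x; rewrite big_cons.
split; first exact: integrable_EFinD.
by rewrite big_cons RintegralD// IH.
Qed.

Lemma ae_Rintegral_eq f g : {ae mu, forall x, f x = g x} ->
  \int[mu]_x f x = \int[mu]_x g x.
Proof.
move=> fg; congr fine; apply: ae_integral_eq.
by apply: filterS fg => x ->.
Qed.

Lemma ae_le_Rintegral f g : mu.-integrable setT (EFin \o f) ->
  mu.-integrable setT (EFin \o g) -> {ae mu, forall x, f x <= g x} ->
  \int[mu]_x f x <= \int[mu]_x g x.
Proof.
move=> fi gi fg; rewrite -subr_ge0 -RintegralB//.
rewrite (@ae_Rintegral_eq _ (fun x => `|g x - f x|)).
  by apply: Rintegral_ge0 => x _.
by apply: filterS fg => x; rewrite -subr_ge0 => /ger0_norm ->.
Qed.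

(** The discriminant argument behind Cauchy-Schwarz. *)
Lemma quadratic_ge0_le (a b c : R) :
  (forall t, 0 <= a + 2 * t * b + t ^+ 2 * c) -> 0 <= c ->
  b <= Num.sqrt a * Num.sqrt c.
Proof.
move=> h c0; have a0 : 0 <= a.
  by have := h 0; rewrite mulr0 mul0r expr0n mul0r !addr0.
suff : b ^+ 2 <= a * c.
  move=> bac; rewrite -sqrtrM//; apply: (le_trans (ler_norm _)).
  by rewrite -sqrtr_sqr ler_wsqrtr.
move: c0; rewrite le_eqVlt => /predU1P[c0|c0].
  have [->|b0] := eqVneq b 0; first by rewrite expr0n mulr_ge0// -c0.
  have := h (- (a + 1) / (2 * b)); rewrite -c0 mulr0 addr0.
  rewrite (_ : 2 * _ * b = - (a + 1)); last by field.
  lra.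
have := h (- b / c).
rewrite (_ : _ + _ = (a * c - b ^+ 2) / c); last by field; rewrite gt_eqF.
by rewrite pmulr_lge0 ?invr_gt0// subr_ge0.
Qed.

End Rintegral_lemmas.

Section test_functions.
Context {R : realType} {N : nat}.
Local Notation mu := (lebesgue_rV R N).
Implicit Types (f g : 'rV[R]_N -> R).

Definition test_function f := bounded_lipschitz f /\
  exists2 M : R, 0 < M & forall x, M <= `|x| -> f x = 0.

Local Notation test := test_function.
Local Notation dd i f := (dir_derive f (delta_mx ord0 i)).

Lemma testM f g : test f -> bounded_lipschitz g -> test (fun x => f x * g x).
Proof.
move=> [fL [M M0 fM]] gL; split; first exact: bounded_lipschitzM.
by exists M => // x /fM ->; rewrite mul0r.
Qed.

Lemma testD f g : test f -> test g -> test (fun x => f x + g x).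
Proof.
move=> [fL [M M0 fM]] [gL [M' M'0 gM]]; split; first exact: bounded_lipschitzD.
exists (Num.max M M') => [|x]; first by rewrite lt_max M0.
by rewrite ge_max => /andP[/fM -> /gM ->]; rewrite addr0.
Qed.

Lemma testZ c f : test f -> test (fun x => c * f x).
Proof.
move=> [fL [M M0 fM]]; split; last by exists M => // x /fM ->; rewrite mulr0.
by apply: bounded_lipschitzM => //; exact: bounded_lipschitz_cst.
Qed.

Lemma test_norm f : test f -> test (fun x => `|f x|).
Proof.
move=> [fL [M M0 fM]]; split; first exact: bounded_lipschitz_norm.
by exists M => // x /fM ->; rewrite normr0.
Qed.

Lemma test_measurable f : bounded_lipschitz f ->
  measurable_fun setT (f : _ -> measurableTypeR R).
Proof. by move=> /bounded_lipschitz_continuous; exact: continuous_measurable_rV. Qed.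

Lemma test_integrable f : test f -> mu.-integrable setT (EFin \o f).
Proof.
move=> [fL [M M0 fM]]; have [L [C [_ _ fC]]] := fL.
apply: (integrable_bounded_support (test_measurable fL) fC).
by move=> x /ltW; exact: fM.
Qed.

Lemma test_dd_bound f i : bounded_lipschitz f -> exists C, forall x, `|dd i f x| <= C.
Proof.
move=> [L [C [L0 fL fC]]]; exists (`|L| * `|delta_mx ord0 i : 'rV[R]_N|) => x.
exact: dir_derive_bound fL.
Qed.

Lemma test_dd_measurable f i : bounded_lipschitz f ->
  measurable_fun setT (dd i f : _ -> measurableTypeR R).
Proof.
by move=> /bounded_lipschitz_continuous cf; exact: measurable_dir_derive.
Qed.

Lemma test_dd_out f : test f -> exists M : R, forall i x, M < `|x| -> dd i f x = 0.
Proof.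
move=> [_ [M M0 fM]]; exists M => i x; apply: dir_derive_out => y /ltW; exact: fM.
Qed.

Lemma test_ddM_integrable f i g C : test f ->
  measurable_fun setT (g : _ -> measurableTypeR R) -> (forall x, `|g x| <= C) ->
  mu.-integrable setT (EFin \o (fun x => dd i f x * g x)).
Proof.
move=> ft mg gC.
have [M fM] := test_dd_out ft; have [C' fC] := test_dd_bound i ft.1.
apply: (@integrable_bounded_support _ _ _ (C' * C) M).
- by apply: measurable_funM => //; exact: test_dd_measurable ft.1.
- by move=> x; rewrite normrM ler_pM.
- by move=> x /(fM i) ->; rewrite mul0r.
Qed.

Lemma testM_integrable f g C : test f ->
  measurable_fun setT (g : _ -> measurableTypeR R) -> (forall x, `|g x| <= C) ->
  mu.-integrable setT (EFin \o (fun x => f x * g x)).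
Proof.
move=> [fL [M M0 fM]] mg gC; have [L [C' [_ _ fC]]] := fL.
apply: (@integrable_bounded_support _ _ _ (C' * C) M).
- by apply: measurable_funM => //; exact: test_measurable.
- by move=> x; rewrite normrM ler_pM.
- by move=> x /ltW/fM ->; rewrite mul0r.
Qed.

Lemma test_derivable f : test f ->
  {ae mu, forall x, forall i : 'I_N, derivable f x (delta_mx ord0 i)}.
Proof.
move=> [[L [C [L0 fL _]]] [M M0 fM]].
apply: filter_forall => i; have [null _] := rademacher i L0 M0 fL fM.
exists [set x | ~ derivable f x (delta_mx ord0 i)]; split => //.
exact: measurableC (measurable_derivable _ (lipschitz_with_continuous fL)).
Qed.

Lemma test_integral_dd f i : test f -> \int[mu]_x dd i f x = 0.
Proof.
move=> [[L [C [L0 fL _]]] [M M0 fM]].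
by have [_ int0] := rademacher i L0 M0 fL fM; rewrite /Rintegral int0.
Qed.

(** The product f g is again a test function, so the integral of its derivative
    vanishes; the product rule holds almost everywhere. *)
Lemma test_by_parts f g i : test f -> test g ->
  \int[mu]_x (dd i f x * g x) = - \int[mu]_x (f x * dd i g x).
Proof.
move=> ft gt; have gL := gt.1; apply/eqP; rewrite -subr_eq0 opprK.
have [L [C [_ _ gC]]] := gL; have [C' dgC] := test_dd_bound i gL.
rewrite -RintegralD//; last 2 first.
- exact: test_ddM_integrable (test_measurable gL) gC.
- exact: testM_integrable (test_dd_measurable i gL) dgC.
rewrite -[X in _ == X](test_integral_dd i (testM ft gL)); apply/eqP.
apply: ae_Rintegral_eq; apply: filterS2 (test_derivable ft) (test_derivable gt).
move=> x /(_ i) df /(_ i) dg; apply/esym.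
rewrite (dir_deriveE df) (dir_deriveE dg).
have := is_deriveM (derivableP df) (derivableP dg).
move=> /is_derive_dir_derive; rewrite [fun x => _](_ : _ = f * g)// => ->.
by rewrite /GRing.scale/= addrC mulrC.
Qed.

End test_functions.

(** * Test functions supported in Omega and their energy *)

Section Lip_c_functions.
Context {R : realType} {N : nat}.
Local Notation mu := (lebesgue_rV R N).
Local Notation dd i f := (dir_derive f (delta_mx ord0 i)).
Local Notation test := test_function.
Implicit Types (Omega K : set 'rV[R]_N) (f xi : 'rV[R]_N -> R).

Lemma compact_bounded_rV K : compact K ->
  exists2 M : R, 0 < M & forall x, K x -> `|x| < M.
Proof.
move=> /compact_bounded[M0 [_ h]]; exists (`|M0| + 2); first by rewrite ltr_wpDl.
move=> x Kx; apply: (@le_lt_trans _ _ (`|M0| + 1)); last by rewrite ltrD2l ltr1n.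
apply: (h (`|M0| + 1)) => //.
by rewrite (le_lt_trans (ler_norm _))// ltrDl.
Qed.

Lemma compact_measurable_rV K : compact K -> measurable K.
Proof.
move=> cK; rewrite -[X in measurable X]setCK; apply: measurableC.
apply: open_measurable_rV; apply: closed_openC.
by apply: compact_closed => //; exact: norm_hausdorff.
Qed.

Lemma Lip_c_test Omega xi : Lip_c Omega xi -> test xi /\
  exists K, [/\ compact K, K `<=` Omega & forall x, ~ K x -> xi x = 0].
Proof.
move=> [xiL cS SO]; set S := closure _ in cS SO.
have S0 x : ~ S x -> xi x = 0.
  move=> xS; apply: contrapT => /eqP x0; apply: xS; exact: subset_closure.
split; last by exists S.
have [M M0 hM] := compact_bounded_rV cS.
have xiM x : M <= `|x| -> xi x = 0.
  by move=> Mx; apply: S0 => /hM; rewrite ltNge Mx.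
have [L L0 xiLL] := pinfty_ex_gt0 xiL.
have {}xiLL : lipschitz_with L xi by move=> x y; exact: (xiLL (x, y)).
split; last by exists M.
exact: (bounded_support_bounded_lipschitz L0 xiLL xiM).
Qed.

Lemma test_Lip_c Omega K f : test f -> compact K -> K `<=` Omega ->
  (forall x, ~ K x -> f x = 0) -> Lip_c Omega f.
Proof.
move=> [[L [C [L0 fL _]]] _] cK KO fK.
have SK : closure [set x | f x != 0] `<=` K.
  rewrite -[X in _ `<=` X](_ : closure K = K).
    apply: closure_subset => x /= fx; apply: contrapT => /fK/eqP.
    by rewrite (negbTE fx).
  by apply/esym/closure_id; apply: compact_closed => //; exact: norm_hausdorff.
split.
- rewrite /lipschitz_on; near=> k => -[x y] _ /=.
  apply: (le_trans (fL x y)); rewrite ler_wpM2r//; near: k.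
- by apply: (subclosed_compact _ cK SK); exact: closed_closure.
- exact: subset_trans KO.
Unshelve. all: by end_near. Qed.

Lemma dir_derive_outside K f v x : closed K -> (forall x, ~ K x -> f x = 0) ->
  ~ K x -> dir_derive f v x = 0.
Proof.
move=> clK fK Kx; rewrite -(dir_derive_cst 0 v x); apply: near_eq_dir_derive.
near=> y; apply: fK; near: y.
by apply: open_nbhs_nbhs; split => //; exact: closed_openC.
Unshelve. all: by end_near. Qed.

End Lip_c_functions.

(** Here W is a Borel function on the whole space that agrees with V almost
    everywhere in Omega. *)
Section potential.
Context {R : realType} {N : nat}.
Local Notation mu := (lebesgue_rV R N).
Local Notation dd i f := (dir_derive f (delta_mx ord0 i)).
Local Notation test := test_function.
Variables (Omega : set 'rV[R]_N) (V W : 'rV[R]_N -> R).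
Hypotheses (mW : measurable_fun setT (W : _ -> measurableTypeR R))
  (VW : {ae mu, forall x, Omega x -> V x = W x})
  (intW : forall K, compact K -> K `<=` Omega ->
    (\int[mu]_(x in K) `|W x|%:E < +oo)%E).
Implicit Types (K : set 'rV[R]_N) (f g xi : 'rV[R]_N -> R).

Definition supported f := test f /\
  exists K, [/\ compact K, K `<=` Omega & forall x, ~ K x -> f x = 0].

Lemma supportedD f g : supported f -> supported g ->
  supported (fun x => f x + g x).
Proof.
move=> [ft [K [cK KO fK]]] [gt [K' [cK' KO' gK]]]; split; first exact: testD.
exists (K `|` K'); split; [exact: compactU|by rewrite subUset|].
by move=> x /not_orP[/fK -> /gK ->]; rewrite addr0.
Qed.

Lemma supportedZ c f : supported f -> supported (fun x => c * f x).
Proof.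
move=> [ft [K [cK KO fK]]]; split; first exact: testZ.
by exists K; split => // x /fK ->; rewrite mulr0.
Qed.

Lemma supported_norm f : supported f -> supported (fun x => `|f x|).
Proof.
move=> [ft [K [cK KO fK]]]; split; first exact: test_norm.
by exists K; split => // x /fK ->; rewrite normr0.
Qed.

(** Stated for any U with |U| <= |W| so as to cover both W and its positive
    part; the factor g is a second test function or the constant 1. *)
Lemma integrable_potential (U : 'rV[R]_N -> R) f g C : supported f ->
  measurable_fun setT (U : _ -> measurableTypeR R) ->
  (forall x, `|U x| <= `|W x|) ->
  measurable_fun setT (g : _ -> measurableTypeR R) -> (forall x, `|g x| <= C) ->
  mu.-integrable setT (EFin \o (fun x => U x * (f x * g x))).
Proof.
move=> [[fL _] [K [cK KO fK]]] mU UW mg gC; have mK := compact_measurable_rV cK.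
have -> : (fun x => U x * (f x * g x)) = (fun x => U x * (f x * g x)) \_ K.
  apply/funext => x; rewrite patchE; case: ifPn => //.
  by rewrite notin_setE => /fK ->; rewrite mul0r mulr0.
rewrite -restrict_EFin; apply/(integrable_mkcond _ mK).
have [L [C' [_ _ fC]]] := fL.
apply: (@integrableMl _ _ _ mu K mK (EFin \o U) (fun x => f x * g x)).
- apply: (@le_integrable _ _ _ mu K mK (EFin \o U) (EFin \o W)).
  + by apply/measurable_EFinP; exact: measurable_funTS.
  + by move=> x _; rewrite /= lee_fin.
  + apply/integrableP; split; last exact: intW.
    by apply/measurable_EFinP; exact: measurable_funTS.
- by apply: measurable_funTS; apply: measurable_funM => //; exact: test_measurable.
- exists (C' * C); split; first by rewrite num_real.
  move=> y Cy x _; rewrite /= (le_trans _ (ltW Cy))// normrM.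
  by rewrite ler_pM.
Qed.

(** The polar form of Qform, written with the Borel representatives of the
    potential and of the gradient. *)
Definition energy f g : R :=
  \int[mu]_x (\sum_(i < N) dd i f x * dd i g x + W x * (f x * g x)).

Lemma supported_bound f : supported f -> exists C, forall x, `|f x| <= C.
Proof. by move=> [[[L [C [_ _ fC]]] _] _]; exists C. Qed.

Lemma supported_measurable f : supported f ->
  measurable_fun setT (f : _ -> measurableTypeR R).
Proof. by move=> [[fL _] _]; exact: test_measurable. Qed.

Lemma energy_integrable f g : supported f -> supported g ->
  [/\ forall i, mu.-integrable setT (EFin \o (fun x => dd i f x * dd i g x)),
      mu.-integrable setT (EFin \o (fun x => \sum_(i < N) dd i f x * dd i g x)),
      mu.-integrable setT (EFin \o (fun x => W x * (f x * g x))) &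
      mu.-integrable setT
        (EFin \o (fun x => \sum_(i < N) dd i f x * dd i g x + W x * (f x * g x)))].
Proof.
move=> fs gs.
have di i : mu.-integrable setT (EFin \o (fun x => dd i f x * dd i g x)).
  have [C dgC] := test_dd_bound i gs.1.1.
  exact: test_ddM_integrable fs.1 (test_dd_measurable i gs.1.1) dgC.
have ds := (Rintegral_sum (index_enum 'I_N) di).1.
have Wi : mu.-integrable setT (EFin \o (fun x => W x * (f x * g x))).
  have [C gC] := supported_bound gs.
  exact: integrable_potential fs mW _ (supported_measurable gs) gC.
by split => //; exact: integrable_EFinD.
Qed.

Lemma Qform_energy f : supported f -> Qform Omega V f = energy f f.
Proof.
move=> fs; have [ft [K [cK KO fK]]] := fs.
have clK : closed K by apply: compact_closed => //; exact: norm_hausdorff.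
rewrite /Qform Rintegral_mkcond; apply: ae_Rintegral_eq.
apply: filterS2 VW (test_derivable ft) => x Vx df.
rewrite patchE; case: ifPn => [|]; rewrite ?inE ?notin_setE => Ox.
  rewrite Vx//; congr (_ + _); rewrite /sqr_norm; apply: eq_bigr => i _.
  by rewrite /gradient mxE expr2 dir_deriveE.
have Kx : ~ K x by move=> /KO.
rewrite fK// mul0r mulr0 addr0 big1// => i _.
by rewrite (dir_derive_outside _ clK fK Kx) mul0r.
Qed.

Lemma energy_expand f g t : supported f -> supported g ->
  energy (fun x => f x + t * g x) (fun x => f x + t * g x) =
  energy f f + 2 * t * energy f g + t ^+ 2 * energy g g.
Proof.
move=> fs gs; rewrite /energy.
have [_ _ _ ff] := energy_integrable fs fs.
have [_ _ _ fg] := energy_integrable fs gs.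
have [_ _ _ gg] := energy_integrable gs gs.
rewrite -(RintegralZl _ measurableT fg) -(RintegralZl _ measurableT gg).
rewrite -RintegralD//; last exact: integrable_EFinZ.
rewrite -RintegralD//; last 2 first.
- by apply: integrable_EFinD => //; exact: integrable_EFinZ.
- exact: integrable_EFinZ.
apply: ae_Rintegral_eq.
apply: filterS2 (test_derivable fs.1) (test_derivable gs.1) => x df dg.
have dE i : dd i (fun x => f x + t * g x) x = dd i f x + t * dd i g x.
  rewrite (dir_deriveE (df i)) (dir_deriveE (dg i)).
  have := is_deriveD (derivableP (df i)) (is_deriveZ t (derivableP (dg i))).
  by move=> /is_derive_dir_derive.
under eq_bigr do rewrite dE.
rewrite (_ : \sum_(i < N) (dd i f x + t * dd i g x) * (dd i f x + t * dd i g x) =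
  \sum_(i < N) dd i f x * dd i f x + 2 * t * \sum_(i < N) dd i f x * dd i g x
  + t ^+ 2 * \sum_(i < N) dd i g x * dd i g x); first by ring.
rewrite !mulr_sumr -!big_split/=; apply: eq_bigr => i _; ring.
Qed.

Hypothesis Q0 : Qform_ge0 Omega V.

Lemma supported_Lip_c f : supported f -> Lip_c Omega f.
Proof. by move=> [ft [K [cK KO fK]]]; exact: test_Lip_c ft cK KO fK. Qed.

Lemma energy_ge0 f : supported f -> 0 <= energy f f.
Proof. by move=> fs; rewrite -Qform_energy//; apply: Q0; exact: supported_Lip_c. Qed.

Lemma energy_Cauchy_Schwarz f g : supported f -> supported g ->
  energy f g <= Num.sqrt (energy f f) * Num.sqrt (energy g g).
Proof.
move=> fs gs; apply: quadratic_ge0_le; last exact: energy_ge0.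
move=> t; rewrite -energy_expand//; apply: energy_ge0.
by apply: supportedD => //; exact: supportedZ.
Qed.

(** At a zero of f where f and |f| are both derivable, the minimum of |f|
    forces both derivatives to vanish. *)
Lemma energy_norm f : supported f ->
  energy (fun x => `|f x|) (fun x => `|f x|) = energy f f.
Proof.
move=> fs; have ns := supported_norm fs; apply: ae_Rintegral_eq.
have fc := bounded_lipschitz_continuous fs.1.1.
apply: filterS2 (test_derivable fs.1) (test_derivable ns.1) => x df dn.
congr (_ + _ * _); last by rewrite -expr2 real_normK ?num_real// expr2.
apply: eq_bigr => i _.
have [fx0|fx0|fx0] := ltgtP (f x) 0.
- have -> : dd i (fun x => `|f x|) x = dd i (\- f) x.
    apply: near_eq_dir_derive; near=> y.
    by rewrite ltr0_norm//; near: y; move/cvgr_lt: (fc x); apply.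
  rewrite (is_derive_dir_derive (is_deriveN (derivableP (df i)))).
  by rewrite mulrNN dir_deriveE.
- have -> : dd i (fun x => `|f x|) x = dd i f x.
    apply: near_eq_dir_derive; near=> y.
    by rewrite gtr0_norm//; near: y; move/cvgr_gt: (fc x); apply.
  by [].
- have := df i => /cvg_ex[d /= fd]; have := dn i => /cvg_ex[d' /= nd].
  have d'0 : d' = 0.
    apply/eqP; rewrite eq_le; apply/andP; split.
      apply: (cvgr_to_le (cvg_dnbhs_at_left nd)); near=> h.
      rewrite fx0 normr0 subr0 /GRing.scale/= mulr_le0_ge0// invr_le0 ltW//.
    apply: (cvgr_to_ge (cvg_dnbhs_at_right nd)); near=> h.
    by rewrite fx0 normr0 subr0 /GRing.scale/= mulr_ge0// invr_ge0 ltW.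
  have d0 : d = 0.
    apply/normr0_eq0; rewrite -(normr0 R) -d'0.
    have cn : `|h^-1 *: (`|f (h *: delta_mx ord0 i + x)| - `|f x|)|
      @[h --> 0^'] --> `|d'| by exact: cvg_norm.
    have cf : `|h^-1 *: (f (h *: delta_mx ord0 i + x) - f x)|
      @[h --> 0^'] --> `|d| by exact: cvg_norm.
    rewrite -(cvg_lim (@Rhausdorff R) cf); apply: cvg_lim; first exact: Rhausdorff.
    apply: cvg_trans cn; apply: near_eq_cvg; near=> h.
    by rewrite fx0 normr0 !subr0 /GRing.scale/= !normrM normr_id.
  rewrite (dir_deriveE (dn i)) (dir_deriveE (df i)).
  rewrite (_ : 'D_ _ _ x = 0); last by rewrite -d'0; exact: cvg_lim nd.
  rewrite (_ : 'D_ _ f x = 0); last by rewrite -d0; exact: cvg_lim fd.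
  by [].
Unshelve. all: by end_near. Qed.


(** * The local estimates and their patching *)

Lemma integrable_patch (f : 'rV[R]_N -> R) (A : set 'rV[R]_N) : measurable A ->
  mu.-integrable setT (EFin \o f) -> mu.-integrable setT (EFin \o (f \_ A)).
Proof.
move=> mA fi; rewrite -restrict_EFin; apply/(integrable_mkcond _ mA).
exact: integrableS fi.
Qed.

Lemma Rintegral_subset_le (f : 'rV[R]_N -> R) (A B : set 'rV[R]_N) :
  measurable A -> measurable B -> A `<=` B -> (forall x, 0 <= f x) ->
  mu.-integrable setT (EFin \o f) ->
  \int[mu]_(x in A) f x <= \int[mu]_(x in B) f x.
Proof.
move=> mA mB AB f0 fi; rewrite Rintegral_mkcond [leRHS]Rintegral_mkcond.
apply: le_Rintegral => //; [exact: integrable_patch..|] => x _.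
rewrite !patchE; case: ifPn => [|_]; last by case: ifP.
by rewrite inE => /AB Bx; rewrite mem_set.
Qed.

Lemma Rintegral_setU_le (f : 'rV[R]_N -> R) (A B : set 'rV[R]_N) :
  measurable A -> measurable B -> (forall x, 0 <= f x) ->
  mu.-integrable setT (EFin \o f) ->
  \int[mu]_(x in A `|` B) f x <=
    \int[mu]_(x in A) f x + \int[mu]_(x in B) f x.
Proof.
move=> mA mB f0 fi; rewrite Rintegral_mkcond [X in _ <= X + _]Rintegral_mkcond
  [X in _ <= _ + X]Rintegral_mkcond -RintegralD//;
  [|exact: integrable_patch..].
apply: le_Rintegral => //.
- by apply: integrable_patch => //; exact: measurableU.
- by apply: integrable_EFinD; exact: integrable_patch.
move=> x _; rewrite !patchE in_setU.
by case: (x \in A); case: (x \in B) => /=; rewrite ?addr0 ?add0r// lerDl.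
Qed.

Definition closed_cube (a : 'rV[R]_N) (r : R) := [set x | `|x - a| <= r].

Lemma closed_cube_closed a r : closed (closed_cube a r).
Proof.
apply: (@closed_comp _ _ (fun x : 'rV[R]_N => `|x - a|) [set x | x <= r]).
  move=> x _; apply: (@lipschitz_with_continuous _ _ 1) => y z.
  by rewrite mul1r (le_trans (ler_dist_dist _ _))// opprB addrA subrK.
exact: closed_le.
Qed.

Lemma closed_cube_compact a r : compact (closed_cube a r).
Proof.
apply: bounded_closed_compact; last exact: closed_cube_closed.
exists (r + `|a|); split; first by rewrite num_real.
move=> y ry x xa /=; rewrite (le_trans _ (ltW ry))//.
by rewrite -[x](subrK a) (le_trans (ler_normD _ _))// lerD2r.
Qed.

Lemma supported_bump a r : 0 < r -> closed_cube a r `<=` Omega ->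
  supported (bump a r).
Proof.
move=> r0 aO; split; last first.
  exists (closed_cube a r); split => //; first exact: closed_cube_compact.
  by move=> x /negP; rewrite -ltNge => /(bump_out r0).
split; first exact: bump_bounded_lipschitz.
exists (`|a| + r + 1) => [|x xM]; first by rewrite ltr_wpDl// addr_ge0// ltW.
apply: bump_out => //; have := ler_normD (x - a) a.
by rewrite subrK; move: xM; lra.
Qed.

Lemma test_bump_deriv (a : 'rV[R]_N) r (i : 'I_N) : 0 < r -> test (bump_deriv a r i).
Proof.
move=> r0; split; first exact: bump_deriv_bounded_lipschitz.
exists (`|a| + r + 1) => [|x xM]; first by rewrite ltr_wpDl// addr_ge0// ltW.
apply: bump_deriv_out => //; have := ler_normD (x - a) a.
by rewrite subrK; move: xM; lra.
Qed.

(** Expand the energy of |xi| and bump: by parts, its gradient term is minus the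
    integral of |xi| times the Laplacian of the bump, which is bounded and
    supported in the cube; the energy itself is bounded by Cauchy-Schwarz. *)
Lemma potential_bump_le a r (U : set 'rV[R]_N) : 0 < r ->
  closed_cube a r `<=` Omega -> closed_cube a r `<=` U -> measurable U ->
  exists2 C : R, 0 <= C & forall xi, supported xi ->
    \int[mu]_x (W x * (`|xi x| * bump a r x)) <=
      C * (Num.sqrt (energy xi xi) + \int[mu]_(x in U) `|xi x|).
Proof.
move=> r0 aO aU mU; have bs := supported_bump r0 aO.
have [C hC] : exists C : 'I_N -> R,
    forall i x, `|dd i (bump_deriv a r i) x| <= C i.
  have /choice[C hC] i := test_dd_bound i (@test_bump_deriv a r i r0).1.
  by exists C.
have C0 i : 0 <= C i by exact: le_trans (hC i 0).
pose S := Num.sqrt (energy (bump a r) (bump a r)).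
have sumC0 : 0 <= \sum_i C i by apply: sumr_ge0.
exists (S + \sum_i C i) => [|xi xs]; first by rewrite addr_ge0// sqrtr_ge0.
have ns := supported_norm xs; have ni := test_integrable ns.1.
have [eD eS eW _] := energy_integrable ns bs.
have -> : \int[mu]_x (W x * (`|xi x| * bump a r x)) =
    energy (fun x => `|xi x|) (bump a r) +
    \sum_i \int[mu]_x (`|xi x| * dd i (bump_deriv a r i) x).
  rewrite /energy RintegralD// (Rintegral_sum _ eD).2.
  rewrite addrAC -big_split/= big1 ?add0r// => i _.
  have -> : \int[mu]_x (dd i (fun x => `|xi x|) x * dd i (bump a r) x) =
      \int[mu]_x (dd i (fun x => `|xi x|) x * bump_deriv a r i x).
    apply: eq_Rintegral => x _.
    by rewrite (is_derive_dir_derive (is_derive_bump a r i x)).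
  by rewrite (test_by_parts i ns.1 (@test_bump_deriv a r i r0)) addNr.
have parts i : \int[mu]_x (`|xi x| * dd i (bump_deriv a r i) x) <=
    C i * \int[mu]_(x in U) `|xi x|.
  have pi := integrable_patch mU ni.
  rewrite [X in _ <= _ * X]Rintegral_mkcond -(RintegralZl _ measurableT pi).
  apply: le_Rintegral => //.
  - apply: testM_integrable (hC i) => //; first exact: ns.1.
    exact: test_dd_measurable (@test_bump_deriv a r i r0).1.
  - exact: integrable_EFinZ.
  move=> x _; rewrite patchE; case: ifPn => [_|].
    by rewrite mulrC ler_wpM2r// (le_trans (ler_norm _)).
  rewrite notin_setE => xU.
  rewrite (dir_derive_outside _ (@closed_cube_closed a r) _ _) ?mulr0//.
    by move=> y /negP; rewrite -ltNge => /(bump_deriv_out r0).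
  by move/aU.
have int0 : 0 <= \int[mu]_(x in U) `|xi x| by apply: Rintegral_ge0.
have h1 := energy_Cauchy_Schwarz ns bs; rewrite energy_norm// -/S in h1.
have h2 : \sum_i \int[mu]_x (`|xi x| * dd i (bump_deriv a r i) x) <=
    (\sum_i C i) * \int[mu]_(x in U) `|xi x|.
  by rewrite mulr_suml; apply: ler_sum => i _.
have S0 : 0 <= S by exact: sqrtr_ge0.
have q0 : 0 <= Num.sqrt (energy xi xi) by exact: sqrtr_ge0.
move: h1 h2 int0 S0 q0 sumC0; move: S (\sum_i C i) (Num.sqrt _) => s c q.
move: (\int[mu]_(x in U) _) (energy _ _) (\sum_i _) => u e b.
by move=> *; nra.
Qed.

(** The estimate to be proved, for open sets instead of compact ones: in this
    form it is local and stable under finite unions. *)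
Definition controlled (A : set 'rV[R]_N) := open A /\ exists U C,
  [/\ open U, compactly_contained U Omega, A `<=` U, 0 <= C &
    forall xi, supported xi ->
      \int[mu]_(x in A) (W^\+ x * `|xi x|) <=
        C * (Num.sqrt (energy xi xi) + \int[mu]_(x in U) `|xi x|)].

Lemma integrable_pos_potential xi : supported xi ->
  mu.-integrable setT (EFin \o (fun x => W^\+ x * `|xi x|)).
Proof.
move=> xs; have ns := supported_norm xs.
have m1 : measurable_fun setT (cst 1 : 'rV[R]_N -> measurableTypeR R) by [].
have c1 (x : 'rV[R]_N) : `|cst 1 x : R| <= 1 by rewrite normr1.
have := @integrable_potential (W^\+) (fun x => `|xi x|) (cst 1) 1 ns _ _ m1 c1.
rewrite (_ : (fun x => _ * (_ * _)) = (fun x => W^\+ x * `|xi x|)); last first.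
  by apply/funext => x; rewrite mulr1.
apply.
  exact: measurable_funrpos.
move=> x; rewrite /funrpos; case: (leP (W x) 0) => //.
by rewrite normr0.
Qed.

Lemma pos_potential_ge0 xi x : 0 <= W^\+ x * `|xi x|.
Proof. by rewrite mulr_ge0. Qed.

Lemma controlled0 : controlled set0.
Proof.
split; first exact: open0.
exists set0, 0; split => //.
- by split; rewrite closure0//; exact: compact0.
by move=> xi _; rewrite mul0r Rintegral_set0.
Qed.

Lemma controlledU A B : controlled A -> controlled B -> controlled (A `|` B).
Proof.
move=> [oA [U [C [oU [cU UO] AU C0 hA]]]] [oB [U' [C' [oU' [cU' UO'] BU C'0 hB]]]].
split; first exact: openU.
exists (U `|` U'), (C + C'); split.
- exact: openU.
- split; rewrite closureU; first exact: compactU.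
  by rewrite subUset.
- exact: setUSS.
- exact: addr_ge0.
move=> xi xs; have ni := test_integrable (supported_norm xs).1.
apply: (le_trans (Rintegral_setU_le (open_measurable_rV oA)
  (open_measurable_rV oB) (pos_potential_ge0 xi) (integrable_pos_potential xs))).
have mU := open_measurable_rV oU; have mU' := open_measurable_rV oU'.
rewrite mulrDl lerD//.
  apply: (le_trans (hA _ xs)); rewrite ler_wpM2l// lerD2l.
  apply: Rintegral_subset_le => //; exact: measurableU.
apply: (le_trans (hB _ xs)); rewrite ler_wpM2l// lerD2l.
apply: Rintegral_subset_le => //; exact: measurableU.
Qed.

Lemma controlled_cover (K : set 'rV[R]_N) : compact K ->
  (forall x, K x -> exists2 A, controlled A & A x) ->
  exists2 A, controlled A & K `<=` A.
Proof.
move=> cK hK.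
have [F hF] : exists F : 'rV[R]_N -> set 'rV[R]_N,
    forall x, K x -> controlled (F x) /\ F x x.
  have /choice[F hF] : forall x, exists A, K x -> controlled A /\ A x.
    move=> x; have [Kx|] := pselect (K x); last by exists set0.
    by have [A cA Ax] := hK x Kx; exists A.
  by exists F.
rewrite compact_cover in cK.
have [|x Kx|D DK KD] := cK _ K F.
- by move=> x /hF[[]].
- by exists x => //; exact: (hF _ Kx).2.
have [A cA DA] : exists2 A, controlled A &
    forall x, x \in finmap.enum_fset D -> F x `<=` A.
  have {}DK x : x \in finmap.enum_fset D -> K x by move=> /DK; rewrite inE.
  elim: (finmap.enum_fset D) DK => [_|x s IH sK].
    by exists set0 => //; exact: controlled0.
  have [A cA sA] := IH (fun y ys => sK y (@mem_behead _ (x :: s) y ys)).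
  exists (F x `|` A).
    by apply: controlledU => //; apply: (hF x _).1; apply: sK; exact: mem_head.
  move=> y; rewrite inE => /predU1P[->|/sA yA]; first exact: subsetUl.
  by apply: subset_trans yA _; exact: subsetUr.
exists A => // x /KD[y /= yD]; exact: DA.
Qed.


Lemma exists_closed_cube (O : set 'rV[R]_N) a : open O -> O a ->
  exists2 r : R, 0 < r & closed_cube a (2 * r) `<=` O.
Proof.
move=> oO Oa; have /nbhs_ballP[e /= e0 eO] : nbhs a O by exact: open_nbhs_nbhs.
exists (e / 4); first by rewrite divr_gt0.
move=> x; rewrite /closed_cube/= => xa; apply: eO.
by rewrite -ball_normE/= distrC (le_lt_trans xa)//; lra.
Qed.

Lemma ball_compactly_contained (a : 'rV[R]_N) r : closed_cube a r `<=` Omega ->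
  compactly_contained (ball a r) Omega.
Proof.
move=> aO; have bc : closure (ball a r) `<=` closed_cube a r.
  rewrite [X in _ `<=` X](closure_id _).1; last exact: closed_cube_closed.
  by apply: closure_subset => x; rewrite -ball_normE/= distrC => /ltW.
split; last exact: subset_trans aO.
apply: (subclosed_compact _ (@closed_cube_compact a r) bc).
exact: closed_closure.
Qed.

Lemma controlled_bounded_above (U : set 'rV[R]_N) a : open U -> U `<=` Omega ->
  ess_bounded_on U V^\+ -> U a -> exists2 A, controlled A & A a.
Proof.
move=> oU UO [M VM] Ua; have [r r0 aU] := exists_closed_cube oU Ua.
have r20 : 0 < 2 * r by rewrite mulr_gt0.
have bU : ball a (2 * r) `<=` U.
  by move=> x; rewrite -ball_normE/= distrC => /ltW /aU.
exists (ball a (2 * r)); last exact: ballxx.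
have mb : measurable (ball a (2 * r)).
  by apply: open_measurable_rV; exact: ball_open.
split; first exact: ball_open.
exists (ball a (2 * r)), `|M|; split => //.
- exact: ball_open.
- apply: ball_compactly_contained; exact: subset_trans UO.
move=> xi xs; have ni := test_integrable (supported_norm xs).1.
rewrite mulrDr ler_wpDl ?mulr_ge0 ?sqrtr_ge0//.
have pi := integrable_patch mb ni.
rewrite Rintegral_mkcond [X in _ <= _ * X]Rintegral_mkcond.
rewrite -(RintegralZl _ measurableT pi).
apply: ae_le_Rintegral.
- by apply: integrable_patch => //; exact: integrable_pos_potential.
- exact: integrable_EFinZ.
apply: filterS2 VW VM => x Vx Mx; rewrite !patchE; case: ifPn => [|_].
  rewrite inE => /bU Ux; rewrite ler_wpM2r//.
  rewrite /funrpos -(Vx (UO _ Ux)) -/(V^\+ x).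
  by rewrite (le_trans (ler_norm _))// (le_trans (Mx Ux))// ler_norm.
by rewrite mulr0.
Qed.

(** With k half the central value of the bump, V^+ is at most k^-1 bump V^+ on
    the neighbourhood where bump > k, and bump V^+ is bump V up to the bounded
    term bump V^-. *)
Lemma controlled_bounded_below (O : set 'rV[R]_N) a : open O -> O `<=` Omega ->
  ess_bounded_on O V^\- -> O a -> exists2 A, controlled A & A a.
Proof.
move=> oO OO [M VM] Oa; have [r r0 aO] := exists_closed_cube oO Oa.
have r20 : 0 < 2 * r by rewrite mulr_gt0.
have rr : closed_cube a r `<=` ball a (2 * r).
  move=> x; rewrite /closed_cube -ball_normE/= distrC => /le_lt_trans; apply.
  by lra.
pose U := ball a (2 * r).
have UO : U `<=` O by move=> x; rewrite /U -ball_normE/= distrC => /ltW /aO.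
have oU : open U by exact: ball_open.
have mU : measurable U by exact: open_measurable_rV.
have rO : closed_cube a r `<=` Omega.
  by apply: subset_trans OO; apply: subset_trans UO.
have bs := supported_bump r0 rO; pose k := bump a r a / 2.
have k0 : 0 < k by rewrite divr_gt0// bump_center.
have bc := bounded_lipschitz_continuous bs.1.1.
pose A := [set x | k < bump a r x].
have oA : open A.
  by apply: (@open_comp _ _ (bump a r) [set y | k < y]);
    [move=> ? _; exact: bc|exact: open_gt].
have AU : A `<=` U.
  move=> x; rewrite /A/= => kx; apply: rr; rewrite /closed_cube/= leNgt.
  by apply/negP => /(bump_out r0) b0; move: kx; rewrite b0 ltNge (ltW k0).
have [C C0 hC] := potential_bump_le r0 rO rr mU.
have [B hB] := supported_bound bs; have B0 : 0 <= B by exact: le_trans (hB 0).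
exists A; last by rewrite /A /k/= ltr_pdivrMr// ltr_pMr ?bump_center// ltr1n.
split => //; exists U, (k^-1 * (C + `|M| * B)); split => //.
- by apply: ball_compactly_contained; exact: subset_trans OO.
- by rewrite mulr_ge0 ?invr_ge0 ?(ltW k0)// addr_ge0// mulr_ge0.
move=> xi xs; have ns := supported_norm xs; have ni := test_integrable ns.1.
have pi := integrable_patch mU ni.
have [_ _ eW _] := energy_integrable ns bs.
apply: (@le_trans _ _ (k^-1 * (\int[mu]_x (W x * (`|xi x| * bump a r x)) +
    `|M| * B * \int[mu]_(x in U) `|xi x|))); last first.
  rewrite -[leRHS]mulrA; apply: ler_wpM2l; first by rewrite invr_ge0 ltW.
  rewrite mulrDl; apply: lerD; first exact: hC.
  by apply: ler_wpM2l; [exact: mulr_ge0|rewrite lerDr sqrtr_ge0].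
rewrite Rintegral_mkcond [X in _ <= _ * (_ + _ * X)]Rintegral_mkcond.
rewrite -(RintegralZl _ measurableT pi) -RintegralD//; last exact: integrable_EFinZ.
rewrite -RintegralZl//; last first.
  by apply: integrable_EFinD => //; exact: integrable_EFinZ.
apply: ae_le_Rintegral.
- by apply: integrable_patch;
    [exact: open_measurable_rV|exact: integrable_pos_potential].
- by apply: integrable_EFinZ; apply: integrable_EFinD => //; exact: integrable_EFinZ.
apply: filterS2 VW VM => x Vx Mx; rewrite !patchE.
have b0 : 0 <= bump a r x by exact: bump_ge0.
have xi0 : 0 <= `|xi x| by [].
have bB : bump a r x <= B by rewrite (le_trans (ler_norm _)).
have [xU|xU] := pselect (U x); last first.
  have -> : bump a r x = 0.
    by apply: bump_out => //; rewrite ltNge; apply/negP => /rr.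
  rewrite !memNset//; last by move=> /AU.
  by rewrite !mulr0 addr0 mulr0.
rewrite (mem_set xU).
have Wx : W^\- x <= `|M|.
  have Vx' := Vx (OO _ (UO _ xU)); rewrite /funrneg -Vx' -/(V^\- x).
  by rewrite (le_trans (ler_norm _))// (le_trans (Mx (UO _ xU)))// ler_norm.
have Wn0 : 0 <= W^\- x by exact: funrneg_ge0.
have Wp0 : 0 <= W^\+ x by exact: funrpos_ge0.
have WE : W x = W^\+ x - W^\- x.
  by have := congr1 (fun h => h x) (funrposBneg W).
have key : bump a r x * W^\+ x * `|xi x| <=
    W x * (`|xi x| * bump a r x) + `|M| * B * `|xi x|.
  have : bump a r x * W^\- x <= B * `|M| by rewrite ler_pM.
  rewrite WE => h; rewrite -subr_ge0.
  have -> : (W^\+ x - W^\- x) * (`|xi x| * bump a r x) + `|M| * B * `|xi x|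
    - bump a r x * W^\+ x * `|xi x| =
    (B * `|M| - bump a r x * W^\- x) * `|xi x| by ring.
  by rewrite mulr_ge0// subr_ge0.
rewrite -ler_pdivrMl ?invr_gt0// invrK; case: ifPn => [|_].
  rewrite inE /A/= => kx; apply: le_trans key.
  by rewrite -mulrA ler_wpM2r ?mulr_ge0// ltW.
rewrite mulr0; apply: le_trans key.
by apply: mulr_ge0 => //; exact: mulr_ge0.
Qed.

End potential.

Theorem proposition6p31 (R : realType) (N : nat) (Omega : set 'rV[R]_N)
    (V : 'rV[R]_N -> R) (hN : (0 < N)%N) (hOmega : domain Omega)
    (hV : class_V Omega V) (hQ : Qform_ge0 Omega V) :
  strongly_balanced Omega V.
Proof.
have [oO _ _] := hOmega.
have [[[W1 mW1 VW1] intV] [J [Uc [cover hU]]]] := hV.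
have mO := open_measurable_rV oO.
pose W := W1 \_ Omega.
have mW : measurable_fun setT (W : _ -> measurableTypeR R).
  by apply/(measurable_restrictT _ mO).
have VW : {ae lebesgue_rV R N, forall x, Omega x -> V x = W x}.
  by apply: filterS VW1 => x Vx Ox; rewrite /W patchE mem_set// Vx.
have intW K : compact K -> K `<=` Omega ->
    (\int[lebesgue_rV R N]_(x in K) `|W x|%:E < +oo)%E.
  move=> cK KO; have := intV K cK KO; rewrite integral_mkcond => h.
  rewrite integral_mkcond (@ae_integral_eq _ _ _ _ _ ((fun x => `|V x|%:E) \_ K))//.
  apply: filterS VW => x Vx; rewrite !patchE; case: ifPn => //.
  by rewrite inE => /KO/Vx ->.
have [lV _] := hV; split => // K cK KO.
have [|A [oA [U [C [oU cU AU C0 hC]]]] KA] :=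
    @controlled_cover R N Omega W mW intW K cK.
  move=> x Kx; have [j _ Ux] := cover _ (KO _ Kx).
  have [oUj [cUj UjO] cases] := hU j.
  case: cases => [VM|[D [oD [_ UjD] [_ DO] VM]]].
  - apply: (controlled_bounded_above mW VW intW oUj _ VM Ux).
    by apply: subset_trans UjO; exact: subset_closure.
  - have Dx : D x by apply: UjD; exact: subset_closure.
    apply: (controlled_bounded_below mW VW intW hQ oD _ VM Dx).
    by apply: subset_trans DO; exact: subset_closure.
have C1 : 0 < C + 1 by rewrite ltr_wpDl.
exists U, (C + 1)^-1; split => //.
- exact: subset_trans AU.
- by rewrite invr_gt0.
move=> xi xiO; have xs : supported Omega xi by exact: Lip_c_test.
rewrite (Qform_energy VW xs) ler_pdivrMl//.
have -> : \int[lebesgue_rV R N]_(x in K) (V^\+ x * `|xi x|) =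
    \int[lebesgue_rV R N]_(x in K) (W^\+ x * `|xi x|).
  rewrite Rintegral_mkcond [RHS]Rintegral_mkcond; apply: ae_Rintegral_eq.
  apply: filterS VW => x Vx; rewrite !patchE; case: ifPn => //.
  by rewrite inE => /KO/Vx; rewrite /funrpos => ->.
apply: (@le_trans _ _ (\int[lebesgue_rV R N]_(x in A) (W^\+ x * `|xi x|))).
  apply: Rintegral_subset_le => //.
  - exact: compact_measurable_rV.
  - exact: open_measurable_rV.
  - exact: pos_potential_ge0.
  - exact: integrable_pos_potential intW _ xs.
apply: (le_trans (hC _ xs)); rewrite ler_wpM2r ?lerDl//.
by rewrite addr_ge0 ?sqrtr_ge0// Rintegral_ge0.
Qed.
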